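(* Let $\mathcal{D}=\left((\mathrm{E}_\alpha)_{\alpha\in I},(e_{\alpha,\beta})_{\alpha\preccurlyeq\beta}\right)$ be a direct system in $\mathbf{NIVL}$, and let $\mathcal{S}=\left(\mathrm{E},(e_\alpha)_{\alpha\in I}\right)$ be the direct limit of $\mathcal{D}$ in $\mathbf{IVL}$. Let $\mathcal{D}^\sim_{\mathrm n}=\left(((\mathrm{E}_\alpha)^\sim_{\mathrm n})_{\alpha\in I},(e_{\alpha,\beta}^\sim)_{\alpha\preccurlyeq\beta}\right)$ be the order continuous dual system. The following statements are true. (i) The inverse limit $\varprojlim\mathcal{D}^\sim_{\mathrm n}=\left(\mathrm{G},(p_\alpha)_{\alpha\in I}\right)$ exists in $\mathbf{NVL}$. (ii) If $e_{\alpha,\beta}$ is injective for all $\alpha\preccurlyeq\beta$ in $I$, then $(\varinjlim\mathcal{D})^\sim_{\mathrm n}\cong\varprojlim\mathcal{D}^\sim_{\mathrm n}$ in $\mathbf{NVL}$; that is, there exists a lattice isomorphism $S:\mathrm{E}^\sim_{\mathrm n}\to\mathrm{G}$ such that $p_\alpha\circ S=e_\alpha^\sim$ (as maps $\mathrm{E}^\sim_{\mathrm n}\to(\mathrm{E}_\alpha)^\sim_{\mathrm n}$) for all $\alpha\in I$.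
   Context: All vector lattices are real. A linear map between vector lattices is a lattice homomorphism if it preserves finite suprema and infima; it is normal if it is moreover order continuous. A positive $T:\mathrm{E}\to\mathrm{F}$ is interval preserving if $T[[0,u]]=[0,T(u)]$ for all $0\le u\in\mathrm{E}$. The categories $\mathbf{NVL}$, $\mathbf{IVL}$, $\mathbf{NIVL}$ have vector lattices as objects; morphisms are, respectively, normal lattice homomorphisms, interval preserving lattice homomorphisms, and normal interval preserving lattice homomorphisms. $\mathrm{E}^\sim$ is the vector lattice of order bounded linear functionals on $\mathrm{E}$ and $\mathrm{E}^\sim_{\mathrm n}$ is the sublattice of order continuous functionals; for a positive operator $T:\mathrm{E}\to\mathrm{F}$, $T^\sim$ is $\varphi\mapsto\varphi\circ T$ (it maps $\mathrm{F}^\sim_{\mathrm n}$ into $\mathrm{E}^\sim_{\mathrm n}$ if $T$ is order continuous). Let $I$ be a directed set. A direct system in a category $\mathbf{C}$ consists of vector lattices $\mathrm{E}_\alpha$ and $\mathbf{C}$-morphisms $e_{\alpha,\beta}:\mathrm{E}_\alpha\to\mathrm{E}_\beta$ ($\alpha\preccurlyeq\beta$) with $e_{\beta,\gamma}\circ e_{\alpha,\beta}=e_{\alpha,\gamma}$ for $\alpha\preccurlyeq\beta\preccurlyeq\gamma$. A compatible system is a vector lattice $\mathrm{E}$ with $\mathbf{C}$-morphisms $e_\alpha:\mathrm{E}_\alpha\to\mathrm{E}$ such that $e_\beta\circ e_{\alpha,\beta}=e_\alpha$; the direct limit in $\mathbf{C}$ is a compatible system $(\mathrm{E},(e_\alpha))$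 such that for every compatible system $(\tilde{\mathrm{E}},(\tilde e_\alpha))$ in $\mathbf{C}$ there is a unique $\mathbf{C}$-morphism $r:\mathrm{E}\to\tilde{\mathrm{E}}$ with $r\circ e_\alpha=\tilde e_\alpha$ for all $\alpha$. An inverse system in $\mathbf{C}$ consists of vector lattices $\mathrm{H}_\alpha$ and $\mathbf{C}$-morphisms $p_{\beta,\alpha}:\mathrm{H}_\beta\to\mathrm{H}_\alpha$ ($\beta\succcurlyeq\alpha$) with $p_{\beta,\alpha}\circ p_{\gamma,\beta}=p_{\gamma,\alpha}$ for $\alpha\preccurlyeq\beta\preccurlyeq\gamma$; compatible systems $(\mathrm{H},(p_\alpha:\mathrm{H}\to\mathrm{H}_\alpha))$ satisfy $p_{\beta,\alpha}\circ p_\beta=p_\alpha$, and the inverse limit in $\mathbf{C}$ is a compatible system such that for every compatible system $(\tilde{\mathrm{H}},(\tilde p_\alpha))$ in $\mathbf{C}$ there is a unique $\mathbf{C}$-morphism $s:\tilde{\mathrm{H}}\to\mathrm{H}$ with $p_\alpha\circ s=\tilde p_\alpha$ for all $\alpha$. The order continuous dual system $\mathcal{D}^\sim_{\mathrm n}$, with maps $e_{\alpha,\beta}^\sim:(\mathrm{E}_\beta)^\sim_{\mathrm n}\to(\mathrm{E}_\alpha)^\sim_{\mathrm n}$, is an inverse system in $\mathbf{NIVL}$. *)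

(* Defs.v *)
From HB Require Import structures.
From mathcomp Require Import all_boot all_order all_algebra.
From mathcomp Require Import lra.
From mathcomp Require Import boolp classical_sets functions set_interval reals.

Set Implicit Arguments.
Unset Strict Implicit.
Unset Printing Implicit Defensive.

Import Order.TTheory GRing.Theory Num.Theory.
Local Open Scope ring_scope.

(* The lattice operations are fields of the mixin rather than being inherited
   from [latticeType]: HB rejects a join of [lmodType] and [latticeType], because
   [realDomainType] already sits below both [zmodType] and [latticeType]. *)
HB.mixin Record Lmodule_POrder_isVectorLattice (R : realType) V
    of GRing.Lmodule R V & Order.POrder ring_display V := {
  vl_lerD2r_subproof : forall z x y : V, x <= y -> x + z <= y + z;
  vl_scaler_ge0 : forall (a : R) (x : V), 0 <= a -> 0 <= x -> 0 <= a *: x;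
  vmeet : V -> V -> V;
  vjoin : V -> V -> V;
  vlexI : forall x y z : V, (x <= vmeet y z) = (x <= y) && (x <= z);
  vleUx : forall x y z : V, (vjoin x y <= z) = (x <= z) && (y <= z)
}.

#[short(type="vectLatticeType")]
HB.structure Definition VectorLattice (R : realType) :=
  { V of GRing.Lmodule R V & Order.POrder ring_display V
       & Lmodule_POrder_isVectorLattice R V }.

Section RegularVectorLattice.
Variable R : realType.

HB.instance Definition _ := Order.POrder.copy R^o R.

Fact regular_lerD2r (z x y : R^o) : x <= y -> x + z <= y + z.
Proof. by rewrite lerD2r. Qed.

Fact regular_scaler_ge0 (a : R) (x : R^o) : 0 <= a -> 0 <= x -> 0 <= a *: x.
Proof. exact: mulr_ge0. Qed.

Fact regular_lexI (x y z : R^o) :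
  (x <= Num.min (y : R) (z : R)) = (x <= y) && (x <= z).
Proof. exact: le_min. Qed.

Fact regular_leUx (x y z : R^o) :
  ((Num.max (x : R) (y : R) : R^o) <= z) = (x <= z) && (y <= z).
Proof. exact: ge_max. Qed.

HB.instance Definition _ := Lmodule_POrder_isVectorLattice.Build R R^o
  regular_lerD2r regular_scaler_ge0 regular_lexI regular_leUx.

End RegularVectorLattice.

Section VectorLatticeTheory.
Context {R : realType} {E : vectLatticeType R}.
Implicit Types (x y z u : E) (a : R).

Lemma vl_lerD2r z x y : (x + z <= y + z) = (x <= y).
Proof.
apply/idP/idP => [/(vl_lerD2r_subproof (- z))|]; first by rewrite !addrK.
exact: vl_lerD2r_subproof.
Qed.

Lemma vl_lerD2l z x y : (z + x <= z + y) = (x <= y).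
Proof. by rewrite ![z + _]addrC vl_lerD2r. Qed.

Lemma vleUl x y : x <= vjoin x y.
Proof. by have := lexx (vjoin x y); rewrite vleUx => /andP[]. Qed.

Lemma vleUr x y : y <= vjoin x y.
Proof. by have := lexx (vjoin x y); rewrite vleUx => /andP[]. Qed.

Lemma vleIl x y : vmeet x y <= x.
Proof. by have := lexx (vmeet x y); rewrite vlexI => /andP[]. Qed.

Lemma vleIr x y : vmeet x y <= y.
Proof. by have := lexx (vmeet x y); rewrite vlexI => /andP[]. Qed.

Lemma vl_subr_ge0 x y : (0 <= y - x) = (x <= y).
Proof. by rewrite -[LHS](vl_lerD2r x) add0r subrK. Qed.

Lemma vl_lerBlDr x y z : (x - y <= z) = (x <= z + y).
Proof. by rewrite -[LHS](vl_lerD2r y) subrK. Qed.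

Lemma vl_lerD x y z u : x <= y -> z <= u -> x + z <= y + u.
Proof.
by move=> xy zu; apply: (@le_trans _ _ (y + z)); rewrite ?vl_lerD2r ?vl_lerD2l.
Qed.

Lemma vl_addr_ge0 x y : 0 <= x -> 0 <= y -> 0 <= x + y.
Proof. by move=> x0 y0; rewrite -[0]addr0; apply: vl_lerD. Qed.

Lemma vl_oppr_le0 x : (- x <= 0) = (0 <= x).
Proof. by rewrite -{1}[- x]add0r vl_lerBlDr add0r. Qed.

Lemma vl_lerZ a x y : 0 <= a -> x <= y -> a *: x <= a *: y.
Proof. by move=> a0 xy; rewrite -vl_subr_ge0 -scalerBr vl_scaler_ge0 ?vl_subr_ge0. Qed.

Lemma vl_joinDr z x y : vjoin x y + z = vjoin (x + z) (y + z).
Proof.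
apply/eqP; rewrite eq_le; apply/andP; split; last first.
  by rewrite vleUx !vl_lerD2r vleUl vleUr.
by rewrite -[z in leLHS]opprK vl_lerBlDr vleUx -!(vl_lerBlDr _ (- z)) opprK vleUl vleUr.
Qed.

Definition vabs x : E := vjoin x (- x).

Lemma vabs_ge x : x <= vabs x. Proof. exact: vleUl. Qed.

Lemma vabs_geN x : - x <= vabs x. Proof. exact: vleUr. Qed.

Lemma vabs_ge0 x : 0 <= vabs x.
Proof.
have : 0 <= 2^-1 *: (vabs x + vabs x).
  apply: vl_scaler_ge0; first by rewrite invr_ge0 ler0n.
  by rewrite -(subrr x); apply: vl_lerD; [exact: vabs_ge | exact: vabs_geN].
by rewrite -mulr2n -scaler_nat scalerA mulVf ?scale1r // pnatr_eq0.
Qed.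

Lemma ge0_vabs x : 0 <= x -> vabs x = x.
Proof.
move=> x0; apply/eqP; rewrite eq_le vabs_ge vleUx lexx /= andbT.
by rewrite (le_trans _ x0) ?vl_oppr_le0.
Qed.

Definition vpos x : E := vjoin x 0.

Lemma vpos_ge x : x <= vpos x. Proof. exact: vleUl. Qed.
Lemma vpos_ge0 x : 0 <= vpos x. Proof. exact: vleUr. Qed.

Lemma vl_riesz_decomposition x y z : 0 <= x -> 0 <= y -> 0 <= z -> z <= x + y ->
  exists z1 z2, [/\ z = z1 + z2, 0 <= z1 <= x & 0 <= z2 <= y].
Proof.
move=> x0 y0 z0 zxy; exists (vmeet z x), (z - vmeet z x).
split; first by rewrite addrC subrK.
  by rewrite vlexI z0 x0 vleIr.
rewrite vl_subr_ge0 vleIl /= vl_lerBlDr addrC -vl_lerBlDr vlexI.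
by rewrite !vl_lerBlDr zxy andbT -[z in z <= _]addr0 vl_lerD2l.
Qed.

End VectorLatticeTheory.

Definition directed d (D : preorderType d) : Prop :=
  (exists a : D, True) /\
  forall a b : D, exists c : D, (a <= c)%O && (b <= c)%O.

Section Operators.
Context {R : realType}.

Definition decreases_to0 (E : vectLatticeType R) d (D : preorderType d)
    (v : D -> E) : Prop :=
  {homo v : a b / (a <= b)%O >-> b <= a} /\ infimums (range v) 0.

(* Order convergence with a dominating net over an index set of its own, so that
   only a tail of the net has to be order bounded. *)
Definition order_cvg (E : vectLatticeType R) d (D : preorderType d)
    (u : D -> E) (x : E) : Prop :=
  exists d' (D' : preorderType d') (v : D' -> E),
    [/\ directed D', decreases_to0 v &
        forall b, exists a0, forall a, (a0 <= a)%O -> vabs (u a - x) <= v b].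

Definition order_continuous (E F : vectLatticeType R) (T : E -> F) : Prop :=
  forall d (D : preorderType d) (u : D -> E) (x : E),
    directed D -> order_cvg u x -> order_cvg (T \o u) (T x).

Definition order_bounded (E F : vectLatticeType R) (T : E -> F) : Prop :=
  forall a b : E, exists c d : F, forall x, a <= x <= b -> c <= T x <= d.

Definition positive_op (E F : vectLatticeType R) (T : E -> F) : Prop :=
  forall x, 0 <= x -> 0 <= T x.

Definition lattice_hom (E F : vectLatticeType R) (T : E -> F) : Prop :=
  {morph T : x y / vjoin x y} /\ {morph T : x y / vmeet x y}.

Definition interval_preserving (E F : vectLatticeType R) (T : E -> F) : Prop :=
  positive_op T /\
  forall u, 0 <= u -> (T @` `[0, u] = `[0, T u])%classic.

End Operators.

Section OrderDual.
Context {R : realType} (E : vectLatticeType R).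

Definition odual_pred : {pred E -> R^o} :=
  fun f => `[< linear f /\ order_bounded f >].

Lemma odual_predP (f : E -> R^o) :
  reflect (linear f /\ order_bounded f) (f \in odual_pred).
Proof. exact: asboolP. Qed.

Lemma order_bounded_funP (f : E -> R^o) : order_bounded f <->
  forall a b, exists M : R, forall x, a <= x <= b -> `|f x : R| <= M.
Proof.
split=> [bf a b|bf a b]; last first.
  have [M fM] := bf a b; exists (- M : R), M => x /fM.
  by rewrite ler_norml.
have [c [d fcd]] := bf a b; exists (Num.max `|c : R| `|d : R|) => x /fcd /andP[cf fd].
rewrite ler_norml; apply/andP; split.
  apply: le_trans cf; rewrite lerNl le_max.
  by apply/orP; left; rewrite -normrN ler_norm.
by apply: (le_trans fd); rewrite le_max ler_norm orbT.
Qed.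

Fact odual_submod_closed : submod_closed odual_pred.
Proof.
split.
  apply/odual_predP; split; first by move=> a u v; rewrite /= scaler0 addr0.
  by move=> a b; exists 0, 0 => x _; rewrite lexx.
move=> c f g /odual_predP[lf /order_bounded_funP bf].
move=> /odual_predP[lg /order_bounded_funP bg].
apply/odual_predP; split.
  move=> a u v; rewrite /= !fctE lf lg !scalerDr !scalerA [c * a]mulrC.
  by rewrite addrACA.
apply/order_bounded_funP => a b; have [M fM] := bf a b; have [N gN] := bg a b.
exists (`|c| * M + N) => x xab; rewrite !fctE.
apply: (le_trans (ler_normD _ _)); apply: lerD; last exact: gN.
by rewrite normrM ler_wpM2l // fM.
Qed.

HB.instance Definition _ := GRing.isSubmodClosed.Build R (E -> R^o) odual_pred
  odual_submod_closed.

Record odual : Type := Odual { odual_fun :> E -> R^o; _ : odual_fun \in odual_pred }.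

HB.instance Definition _ := [isSub for odual_fun].
HB.instance Definition _ := [Choice of odual by <:].
HB.instance Definition _ := [SubChoice_isSubLmodule of odual by <:].

Lemma odual_linear (f : odual) : linear f.
Proof. by have /odual_predP[] := valP f. Qed.

HB.instance Definition _ (f : odual) :=
  GRing.isLinear.Build R E R^o *:%R f (odual_linear f).

Lemma odualB (f : odual) x y : f (x - y) = f x - f y.
Proof. exact: linearB. Qed.

Lemma odual_bounded (f : odual) : order_bounded f.
Proof. by have /odual_predP[] := valP f. Qed.

Lemma odualP (f g : odual) : f =1 g -> f = g.
Proof. by move=> fg; apply/val_inj/funext. Qed.

Lemma odualDE (f g : odual) x : (f + g) x = f x + g x. Proof. by []. Qed.
Lemma odualNE (f : odual) x : (- f) x = - f x. Proof. by []. Qed.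
Lemma odualZE a (f : odual) x : (a *: f) x = a *: f x. Proof. by []. Qed.
Lemma odual0E x : (0 : odual) x = 0. Proof. by []. Qed.

Definition odual_le (f g : odual) : bool := `[< forall x, 0 <= x -> f x <= g x >].

Lemma vpos_sub (x : E) : x = vpos x - vpos (- x).
Proof.
apply/eqP; rewrite eq_sym subr_eq addrC /vpos vl_joinDr addNr add0r.
apply/eqP/le_anti; rewrite !vleUx.
by rewrite vleUl vleUr vleUl vleUr.
Qed.

Fact odual_le_refl : reflexive odual_le.
Proof. by move=> f; apply/asboolP. Qed.

Fact odual_le_anti : antisymmetric odual_le.
Proof.
move=> f g /andP[/asboolP fg /asboolP gf]; apply: odualP => x.
have fgE y : 0 <= y -> f y = g y.
  by move=> y0; apply: le_anti; rewrite fg ?gf.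
by rewrite [x]vpos_sub !linearB /= !fgE ?vpos_ge0.
Qed.

Fact odual_le_trans : transitive odual_le.
Proof.
move=> g f h /asboolP fg /asboolP gh; apply/asboolP => x x0.
by apply: le_trans (gh _ x0); apply: fg.
Qed.

HB.instance Definition _ := Order.Le_isPOrder.Build ring_display odual
  odual_le_refl odual_le_anti odual_le_trans.

Lemma odual_leP (f g : odual) :
  reflect (forall x, 0 <= x -> f x <= g x) (f <= g).
Proof. exact: asboolP. Qed.

(* Riesz-Kantorovich formula: f^+ x = sup f[0, x] for x >= 0. *)
Section RieszKantorovich.
Variable f : odual.

Definition rk (x : E) : R := sup (f @` [set y | 0 <= y <= x])%classic.

Lemma rk_has_sup x : 0 <= x -> has_sup (f @` [set y | 0 <= y <= x])%classic.
Proof.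
move=> x0; split; first by exists (f 0), 0 => //=; rewrite lexx.
have [c [d fcd]] := odual_bounded f 0 x; exists d => _ [y /= yx <-].
by have /andP[] := fcd _ yx.
Qed.

Lemma rk_ge x y : 0 <= y <= x -> f y <= rk x.
Proof.
move=> yx; apply: sup_upper_bound; last by exists y.
by apply: rk_has_sup; case/andP: yx; apply: le_trans.
Qed.

Lemma rk_le x (c : R) : 0 <= x -> (forall y, 0 <= y <= x -> f y <= c) -> rk x <= c.
Proof.
move=> x0 fc; apply: ge_sup; first by have [] := rk_has_sup x0.
by move=> _ [y /= yx <-]; apply: fc.
Qed.

Lemma rk_ge0 x : 0 <= x -> 0 <= rk x.
Proof. by move=> x0; rewrite -(linear0 f) rk_ge ?lexx. Qed.

Lemma rkD x y : 0 <= x -> 0 <= y -> rk (x + y) = rk x + rk y.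
Proof.
move=> x0 y0; apply/le_anti/andP; split.
  apply: rk_le => [|z /andP[z0 zxy]]; first exact: vl_addr_ge0.
  have [z1 [z2 [-> z1x z2y]]] := vl_riesz_decomposition x0 y0 z0 zxy.
  by rewrite linearD; apply: lerD; apply: rk_ge.
rewrite -lerBrDr; apply: rk_le => // z /andP[z0 zx].
rewrite lerBrDr -lerBrDl; apply: rk_le => // t /andP[t0 ty].
rewrite lerBrDl.
have <- : f (z + t) = (f z : R) + (f t : R) by rewrite linearD.
by apply: rk_ge; rewrite vl_addr_ge0 // vl_lerD.
Qed.

Lemma rkZ (a : R) x : 0 <= a -> 0 <= x -> rk (a *: x) = a * rk x.
Proof.
have le_rkZ (b : R) z : 0 < b -> 0 <= z -> rk (b *: z) <= b * rk z.
  move=> b0 z0; apply: rk_le => [|y /andP[y0 yz]].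
    by rewrite vl_scaler_ge0 // ltW.
  have -> : f y = b * (f (b^-1 *: y) : R).
    by rewrite linearZ /= mulrA mulfV ?mul1r // gt_eqF.
  rewrite ler_pM2l //; apply: rk_ge.
  rewrite vl_scaler_ge0 ?invr_ge0 ?(ltW b0) //=.
  have -> : z = b^-1 *: (b *: z) by rewrite scalerA mulVf ?scale1r ?gt_eqF.
  by rewrite vl_lerZ // invr_ge0 ltW.
rewrite le_eqVlt => /orP[/eqP <- _|a0 x0].
  rewrite scale0r mul0r; apply/le_anti; rewrite rk_ge0 // andbT.
  by apply: rk_le => // y /le_anti <-; rewrite linear0.
apply/le_anti; rewrite le_rkZ //=.
rewrite -ler_pdivlMl //.
have {1}-> : x = a^-1 *: (a *: x) by rewrite scalerA mulVf ?scale1r ?gt_eqF.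
by apply: le_rkZ; rewrite ?invr_gt0 // vl_scaler_ge0 // ltW.
Qed.

Definition rkext (x : E) : R^o := rk (vpos x) - rk (vpos (- x)).

Lemma rkext_diff u v : 0 <= u -> 0 <= v -> rkext (u - v) = rk u - rk v.
Proof.
move=> u0 v0; rewrite /rkext.
suff : rk (vpos (u - v)) + rk v = rk u + rk (vpos (- (u - v))).
  by move=> h; apply/eqP; rewrite subr_eq addrAC eq_sym subr_eq eq_sym h.
rewrite -!rkD ?vpos_ge0 //; congr rk.
have -> : vpos (u - v) = u - v + vpos (- (u - v)).
  by apply/eqP; rewrite -subr_eq -vpos_sub.
by rewrite addrAC subrK.
Qed.

Lemma rkext_linear : linear rkext.
Proof.
have NZ (u : E) : rkext (- u) = - rkext u by rewrite /rkext opprK opprB.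
have D u v : rkext (u + v) = rkext u + rkext v.
  rewrite {1}[u]vpos_sub {1}[v]vpos_sub addrACA -opprD.
  by rewrite rkext_diff ?vl_addr_ge0 ?vpos_ge0 // !rkD ?vpos_ge0 // opprD addrACA.
have Z (a : R) u : 0 <= a -> rkext (a *: u) = a *: rkext u.
  move=> a0; rewrite {1}[u]vpos_sub scalerBr.
  by rewrite rkext_diff ?vl_scaler_ge0 ?vpos_ge0 // !rkZ ?vpos_ge0 // -mulrBr.
move=> a u v; rewrite D; congr (_ + _).
have [a0|/ltW a0] := leP 0 a; first exact: Z.
by rewrite -[a]opprK scaleNr NZ Z ?oppr_ge0 // [in RHS]scaleNr.
Qed.

Lemma rkext_ge0 x : 0 <= x -> rkext x = rk x.
Proof.
move=> x0; have {1}-> : x = x - 0 by rewrite subr0.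
rewrite rkext_diff //; have -> : rk 0 = 0; last by rewrite subr0.
by have := rkZ (lexx 0) x0; rewrite scale0r mul0r.
Qed.

Lemma rkext_pred : rkext \in odual_pred.
Proof.
apply/odual_predP; split; first exact: rkext_linear.
have mono x y : x <= y -> rkext x <= rkext y.
  move=> xy; rewrite -[y](subrK x) -[y - x]scale1r rkext_linear scale1r lerDr.
  by rewrite rkext_ge0 ?rk_ge0 // vl_subr_ge0.
by move=> a b; exists (rkext a), (rkext b) => x /andP[ax xb]; rewrite !mono.
Qed.

Definition odual_pos : odual := Odual rkext_pred.

Lemma odual_posE x : 0 <= x -> odual_pos x = rk x.
Proof. exact: rkext_ge0. Qed.

Lemma odual_pos_le (g : odual) : (odual_pos <= g) = (f <= g) && (0 <= g).
Proof.
apply/idP/andP => [/odual_leP pg|[/odual_leP fg /odual_leP g0]].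
  split; apply/odual_leP => x x0; apply: le_trans (pg _ x0); rewrite odual_posE //.
    by rewrite rk_ge // x0 lexx.
  exact: rk_ge0.
apply/odual_leP => x x0; rewrite odual_posE //; apply: rk_le => // y /andP[y0 yx].
apply: (le_trans (fg _ y0)).
have gxy : 0 <= g (x - y) by rewrite g0 // vl_subr_ge0.
by rewrite -[x](subrK y) linearD lerDr.
Qed.

End RieszKantorovich.

Fact odual_lerD2r (h f g : odual) : f <= g -> f + h <= g + h.
Proof. by move=> /odual_leP fg; apply/odual_leP => x x0; rewrite lerD2r fg. Qed.

Fact odual_scaler_ge0 (a : R) (f : odual) : 0 <= a -> 0 <= f -> 0 <= a *: f.
Proof.
by move=> a0 /odual_leP f0; apply/odual_leP => x x0; apply: mulr_ge0; rewrite ?f0.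
Qed.

Definition odual_join (f g : odual) : odual := odual_pos (f - g) + g.
Definition odual_meet (f g : odual) : odual := f - odual_pos (f - g).

Let lerB (f g h : odual) : (f - h <= g) = (f <= g + h).
Proof.
apply/idP/idP => [/(odual_lerD2r h)|/(odual_lerD2r (- h))]; by rewrite ?subrK ?addrK.
Qed.

Fact odual_lexI (f g h : odual) :
  (f <= odual_meet g h) = (f <= g) && (f <= h).
Proof.
rewrite /odual_meet -[f <= _](_ : (f + odual_pos (g - h) <= g) = _); last first.
  by rewrite -[X in f + X]opprK lerB.
rewrite addrC -[X in _ + X]opprK lerB odual_pos_le andbC; congr (_ && _).
  by rewrite -lerB opprK add0r.
by rewrite lerB addrAC -lerB opprK ![g + _]addrC -lerB addrK.
Qed.

Fact odual_leUx (f g h : odual) :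
  (odual_join f g <= h) = (f <= h) && (g <= h).
Proof.
rewrite /odual_join -[X in _ + X]opprK lerB odual_pos_le.
by rewrite lerB subrK -lerB opprK add0r.
Qed.

HB.instance Definition _ := Lmodule_POrder_isVectorLattice.Build R odual
  odual_lerD2r odual_scaler_ge0 odual_lexI odual_leUx.

End OrderDual.

Lemma regular_order_cvgP (R : realType) d (D : preorderType d) (u : D -> R^o)
    (x : R^o) : order_cvg u x <->
  forall eps : R, 0 < eps ->
    exists a0, forall a, (a0 <= a)%O -> `|(u a - x : R)| <= eps.
Proof.
have vabsE (y c : R^o) : (vabs y <= c) = (`|(y : R)| <= c).
  by rewrite vleUx ler_norml andbC lerNl.
split=> [[d' [D' [v [_ [_ [_ v0] uv]]]]] eps eps0|ux].
  have [b vb] : exists b, v b < eps.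
    apply/not_existsP => ltv; have /v0 : lbound (range v) (eps : R^o).
      by move=> _ [b _ <-]; rewrite leNgt; apply/negP/ltv.
    by rewrite leNgt eps0.
  have [a0 ua0] := uv b; exists a0 => a /ua0.
  by rewrite vabsE => /le_trans; apply; apply: ltW.
exists _, nat, (fun n => n.+1%:R^-1 : R^o); split.
- split; first by exists 0%N.
  by move=> m n; exists (maxn m n); rewrite !leEnat leq_maxl leq_maxr.
- split=> [m n mn|]; first by rewrite lef_pV2 ?posrE ?ltr0Sn // ler_nat ltnS.
  split=> [_ [n _ <-]|z lbz]; first by rewrite invr_ge0 ler0n.
  rewrite leNgt; apply/negP => z0.
  have : z <= (Num.truncn ((z : R)^-1)).+1%:R^-1 by apply: lbz; exists (Num.truncn (z : R)^-1).
  apply/negP; rewrite -ltNge invf_plt ?posrE ?ltr0Sn //.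
  by rewrite truncnS_gt.
- move=> n; have [|a0 ua0] := ux n.+1%:R^-1; first by rewrite invr_gt0 ltr0Sn.
  by exists a0 => a /ua0; rewrite vabsE.
Qed.

Section OrderContinuousDual.
Context {R : realType} (E : vectLatticeType R).
Local Notation "E ^~" := (odual E) (at level 2, format "E ^~").

(* Order continuity is that of operators into R, where R carries order
   convergence; regular_order_cvgP identifies it with the usual convergence. *)
Definition ncdual_pred : {pred E^~} := fun f => `[< order_continuous f >].

Lemma ncdual_predP (f : E^~) : reflect (order_continuous f) (f \in ncdual_pred).
Proof. exact: asboolP. Qed.

Fact ncdual_submod_closed : submod_closed ncdual_pred.
Proof.
split.
  apply/ncdual_predP => d D u x [[a0 _] _] _; apply/regular_order_cvgP => e e0.
  by exists a0 => a _; rewrite /= subr0 normr0 ltW.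
move=> c f g /ncdual_predP ocf /ncdual_predP ocg.
apply/ncdual_predP => d D u x dD ux; apply/regular_order_cvgP => e e0.
have c0 : 0 < `|c| + 1 by rewrite ltr_wpDl.
have /regular_order_cvgP/(_ (e / 2 / (`|c| + 1))) := ocf _ _ _ _ dD ux.
case=> [|a0 fa0]; first by rewrite !divr_gt0.
have /regular_order_cvgP/(_ (e / 2)) := ocg _ _ _ _ dD ux.
case=> [|a1 ga1]; first by rewrite divr_gt0.
have [a2 /andP[a02 a12]] := dD.2 a0 a1.
exists a2 => a a2a; have := fa0 _ (le_trans a02 a2a); have := ga1 _ (le_trans a12 a2a).
move=> gle fle.
have -> : (((c *: f + g) \o u) a - (c *: f + g) x : R) =
    c * ((f \o u) a - f x) + ((g \o u) a - g x).
  by rewrite mulrBr addrACA -opprD.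
apply: (le_trans (ler_normD _ _)); rewrite [e in leRHS]splitr.
apply: lerD gle; rewrite normrM.
apply: (@le_trans _ _ (`|c| * (e / 2 / (`|c| + 1)))).
  by rewrite ler_wpM2l.
rewrite mulrCA; apply: ler_piMr; first by rewrite ltW // divr_gt0.
by rewrite ler_pdivrMr // mul1r lerDl ler01.
Qed.

HB.instance Definition _ := GRing.isSubmodClosed.Build R E^~ ncdual_pred
  ncdual_submod_closed.

Lemma odual_pos_decreases (f : E^~) d (D : preorderType d) (v : D -> E) (e : R) :
  order_continuous f -> directed D -> decreases_to0 v -> 0 < e ->
  exists b, (odual_pos f (v b) : R) < e.
Proof.
move=> ocf dD dv e0.
have [g gE] : exists g : E^~, g = odual_pos f by exists (odual_pos f).
have rkE z : 0 <= z -> g z = rk f z by rewrite gE; apply: odual_posE.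
rewrite -gE; have [dec [lb0 inf0]] := dv; have [[b0 _] dirD] := dD.
have v0 b : 0 <= v b by apply: lb0; exists b.
have e2 : 0 < e / 2 by rewrite divr_gt0.
have [_ [y /= /andP[y0 yX] <-] fy] := sup_adherent e2 (rk_has_sup f (v0 b0)).
have : order_cvg (fun b => vmeet y (v b)) 0.
  exists _, D, v; split=> // b; exists b => a ba; rewrite subr0 ge0_vabs.
    by rewrite (le_trans (vleIr _ _)) ?dec.
  by rewrite vlexI y0 v0.
move=> /(ocf _ _ _ _ dD)/regular_order_cvgP/(_ _ e2)[b1 fb1].
have [b /andP[b0b b1b]] := dirD b0 b1; exists b.
have := fb1 b b1b; rewrite /= linear0 subr0 ler_norml => /andP[_ fyb].
rewrite -/(rk f (v b0)) in fy.
have : f (y - vmeet y (v b)) <= g (v b0 - v b).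
  rewrite rkE ?vl_subr_ge0 ?dec //; apply: rk_ge.
  rewrite vl_subr_ge0 vleIl /= vl_lerBlDr addrC -vl_lerBlDr vlexI !vl_lerBlDr.
  by rewrite [v b + _]addrC subrK yX -{1}[y]addr0 vl_lerD2l vl_subr_ge0 dec.
rewrite !odualB [g (v b0)]rkE // => h.
have {}h : (f y : R) - (f (vmeet y (v b)) : R) <= rk f (v b0) - (g (v b) : R) by [].
move: h fy fyb.
move: (f y : R) (f (vmeet _ _) : R) (rk _ _) (g _ : R) => p q r s.
lra.
Qed.

Lemma ncdual_pos_closed (f : E^~) : f \in ncdual_pred -> odual_pos f \in ncdual_pred.
Proof.
move=> /ncdual_predP ocf; apply/ncdual_predP => d D u x dD [d' [D' [v [dD' dv uv]]]].
apply/regular_order_cvgP => e e0.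
have [b vb] := odual_pos_decreases ocf dD' dv e0.
have [a0 ua0] := uv b; exists a0 => a /ua0 uvb.
have [g gE] : exists g : E^~, g = odual_pos f by exists (odual_pos f).
rewrite -gE in vb *.
have g0 z : 0 <= z -> 0 <= g z by move=> z0; rewrite gE odual_posE // rk_ge0.
have gmono y z : y <= z -> g y <= g z.
  by move=> yz; rewrite -subr_ge0 -(odualB g) g0 // vl_subr_ge0.
have gN y : g (- y) = - g y by exact: linearN.
rewrite -(odualB g (u a)); apply: le_trans (ltW vb); rewrite ler_norml lerNl -gN.
by rewrite !gmono // (le_trans _ uvb) ?vabs_ge ?vabs_geN.
Qed.

Record ncdual : Type := NcDual { ncdual_fun :> E^~; _ : ncdual_fun \in ncdual_pred }.

HB.instance Definition _ := [isSub for ncdual_fun].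
HB.instance Definition _ := [Choice of ncdual by <:].
HB.instance Definition _ := [SubChoice_isSubLmodule of ncdual by <:].
HB.instance Definition _ :=
  Order.SubChoice_isSubPOrder.Build ring_display E^~ ncdual_pred ring_display ncdual.

(* By Ogasawara's theorem (ncdual_pos_closed) the order continuous functionals
   form a sublattice of the order dual, whose operations are used here. *)
Fact ncdual_join_closed (f g : ncdual) :
  vjoin (f : E^~) (g : E^~) \in ncdual_pred.
Proof. by rewrite rpredD ?ncdual_pos_closed ?rpredB ?(valP f) ?(valP g). Qed.

Fact ncdual_meet_closed (f g : ncdual) :
  vmeet (f : E^~) (g : E^~) \in ncdual_pred.
Proof. by rewrite rpredB ?ncdual_pos_closed ?rpredB ?(valP f) ?(valP g). Qed.

Definition ncdual_join (f g : ncdual) : ncdual := NcDual (ncdual_join_closed f g).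
Definition ncdual_meet (f g : ncdual) : ncdual := NcDual (ncdual_meet_closed f g).

Fact ncdual_lerD2r (h f g : ncdual) : f <= g -> f + h <= g + h.
Proof. exact: (@odual_lerD2r _ E (val h) (val f) (val g)). Qed.

Fact ncdual_scaler_ge0 (a : R) (f : ncdual) : 0 <= a -> 0 <= f -> 0 <= a *: f.
Proof. exact: (@odual_scaler_ge0 _ E a (val f)). Qed.

Fact ncdual_lexI (f g h : ncdual) :
  (f <= ncdual_meet g h) = (f <= g) && (f <= h).
Proof. exact: (@odual_lexI _ E (val f) (val g) (val h)). Qed.

Fact ncdual_leUx (f g h : ncdual) :
  (ncdual_join f g <= h) = (f <= h) && (g <= h).
Proof. exact: (@odual_leUx _ E (val f) (val g) (val h)). Qed.

HB.instance Definition _ := Lmodule_POrder_isVectorLattice.Build R ncdual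
  ncdual_lerD2r ncdual_scaler_ge0 ncdual_lexI ncdual_leUx.


Lemma ncdualP (f g : ncdual) : f =1 g -> f = g.
Proof. by move=> fg; apply/val_inj/odualP. Qed.

End OrderContinuousDual.

Section Adjoint.
Context {R : realType} {E F : vectLatticeType R}.
Variables (T : {linear E -> F}) (T0 : positive_op T) (Toc : order_continuous T).

Fact adjoint_odual (phi : odual F) : (phi \o T : E -> R^o) \in @odual_pred R E.
Proof.
apply/odual_predP; split; first by move=> a u v; rewrite /= !linearP.
have mono x y : x <= y -> T x <= T y.
  by move=> xy; rewrite -vl_subr_ge0 -linearB T0 // vl_subr_ge0.
move=> a b; have [c [c' phicc']] := odual_bounded phi (T a) (T b).
by exists c, c' => x /andP[ax xb]; rewrite phicc' // !mono.
Qed.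

Definition odual_map (phi : odual F) : odual E := Odual (adjoint_odual phi).

Fact adjoint_ncdual (phi : ncdual F) : odual_map phi \in @ncdual_pred R E.
Proof.
apply/ncdual_predP => d D u x dD ux.
have /ncdual_predP := valP phi; apply=> //.
exact: Toc.
Qed.

Definition ncdual_map (phi : ncdual F) : ncdual E := NcDual (adjoint_ncdual phi).

Fact ncdual_map_linear : linear ncdual_map.
Proof. by move=> a phi psi; apply: ncdualP => x. Qed.

HB.instance Definition _ :=
  GRing.isLinear.Build R (ncdual F) (ncdual E) *:%R ncdual_map ncdual_map_linear.

Lemma ncdual_mapE (phi : ncdual F) x : ncdual_map phi x = phi (T x).
Proof. by []. Qed.

End Adjoint.

(* A category whose objects are all vector lattices over R, given by the linear
   maps which are its morphisms. *)
Definition vl_category (R : realType) : Type :=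
  forall E F : vectLatticeType R, {linear E -> F} -> Prop.

Section Categories.
Context {R : realType}.

Definition NVL : vl_category R := fun E F T =>
  lattice_hom T /\ order_continuous T.

Definition IVL : vl_category R := fun E F T =>
  lattice_hom T /\ interval_preserving T.

Definition NIVL : vl_category R := fun E F T =>
  [/\ lattice_hom T, order_continuous T & interval_preserving T].

Lemma NIVL_positive (E F : vectLatticeType R) (T : {linear E -> F}) :
  NIVL T -> positive_op T.
Proof. by case=> _ _ []. Qed.

Lemma NIVL_order_continuous (E F : vectLatticeType R) (T : {linear E -> F}) :
  NIVL T -> order_continuous T.
Proof. by case. Qed.

End Categories.

(* Systems are diagrams of linear maps with no category attached, since a system
   in one category has its limit taken in another. The composition law is asked
   for exactly as a <= b <= c, with no separate identity axiom on a <= a. *)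
Section Limits.
Context (R : realType) (d : Order.disp_t) (I : preorderType d).

Record direct_system := DirectSystem {
  ds_obj :> I -> vectLatticeType R;
  ds_map : forall a b, (a <= b)%O -> {linear ds_obj a -> ds_obj b};
  ds_comp : forall a b c (ab : (a <= b)%O) (bc : (b <= c)%O) (ac : (a <= c)%O) x,
    ds_map bc (ds_map ab x) = ds_map ac x
}.

Record inverse_system := InverseSystem {
  ivs_obj :> I -> vectLatticeType R;
  ivs_map : forall a b, (a <= b)%O -> {linear ivs_obj b -> ivs_obj a};
  ivs_comp : forall a b c (ab : (a <= b)%O) (bc : (b <= c)%O) (ac : (a <= c)%O) x,
    ivs_map ab (ivs_map bc x) = ivs_map ac x
}.

Variable C : vl_category R.

Definition direct_system_in (D : direct_system) : Prop :=
  forall a b (ab : (a <= b)%O), C (ds_map D ab).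

Definition direct_compatible (D : direct_system) (E : vectLatticeType R)
    (e : forall a, {linear D a -> E}) : Prop :=
  (forall a, C (e a)) /\
  forall a b (ab : (a <= b)%O) x, e b (ds_map D ab x) = e a x.

Definition is_direct_limit (D : direct_system) (E : vectLatticeType R)
    (e : forall a, {linear D a -> E}) : Prop :=
  direct_compatible e /\
  forall (E' : vectLatticeType R) (e' : forall a, {linear D a -> E'}),
    direct_compatible e' ->
    exists r : {linear E -> E'},
      [/\ C r, forall a x, r (e a x) = e' a x &
          forall r' : {linear E -> E'},
            C r' -> (forall a x, r' (e a x) = e' a x) -> r' =1 r].

Definition inverse_compatible (H : inverse_system) (G : vectLatticeType R)
    (p : forall a, {linear G -> H a}) : Prop :=
  (forall a, C (p a)) /\
  forall a b (ab : (a <= b)%O) x, ivs_map H ab (p b x) = p a x.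

Definition is_inverse_limit (H : inverse_system) (G : vectLatticeType R)
    (p : forall a, {linear G -> H a}) : Prop :=
  inverse_compatible p /\
  forall (G' : vectLatticeType R) (p' : forall a, {linear G' -> H a}),
    inverse_compatible p' ->
    exists s : {linear G' -> G},
      [/\ C s, forall a x, p a (s x) = p' a x &
          forall s' : {linear G' -> G},
            C s' -> (forall a x, p a (s' x) = p' a x) -> s' =1 s].

End Limits.

Section DualSystem.
Context (R : realType) (d : Order.disp_t) (I : preorderType d).
Variables (D : direct_system R I) (DN : direct_system_in NIVL D).

Definition ncdual_system_map a b (ab : (a <= b)%O) :
    {linear ncdual (D b) -> ncdual (D a)} :=
  ncdual_map (NIVL_positive (DN ab)) (NIVL_order_continuous (DN ab)).

Fact ncdual_system_comp a b c (ab : (a <= b)%O) (bc : (b <= c)%O)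
    (ac : (a <= c)%O) (phi : ncdual (D c)) :
  ncdual_system_map ab (ncdual_system_map bc phi) = ncdual_system_map ac phi.
Proof. by apply: ncdualP => x; rewrite /= (ds_comp ab bc ac). Qed.

Definition ncdual_system : inverse_system R I :=
  InverseSystem ncdual_system_comp.

End DualSystem.

(* Main.v *)
(** A thread is an element of the product of the order continuous duals that is
   compatible with the connecting maps. Decreasing nets of positive order
   continuous functionals converge pointwise to an order continuous functional,
   and pointwise limits of threads are threads; so the projections of the space
   of threads are order continuous, and this space is the inverse limit.

   If the connecting maps are injective, so are the [e a]: the [D a] embed as
   ideals into the union of their images in the reduced product of the [D a]
   (families modulo eventual equality), which is a compatible system. By
   uniqueness in the universal property, [E] is the union of the images of the
   [e a]. Hence [E] is a directed union of ideals isomorphic to the [D a], and a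
   net that order converges to 0 in [E] eventually does so inside one of them;
   thus compatible order continuous functionals on the [D a] glue to an order
   continuous functional on [E]. *)

Require Import Defs.
From HB Require Import structures.
From mathcomp Require Import all_boot all_order all_algebra.
From mathcomp Require Import generic_quotient.
From mathcomp Require Import boolp classical_sets functions set_interval reals.

Set Implicit Arguments.
Unset Strict Implicit.
Unset Printing Implicit Defensive.

Import Order.TTheory GRing.Theory Num.Theory.
Local Open Scope ring_scope.

(** * Lattice homomorphisms, order continuity and interval preservation *)

Section VectorLattices.
Context {R : realType}.
Implicit Types E F : vectLatticeType R.

Lemma vjoin_idPr E (x y : E) : x <= y <-> vjoin x y = y.
Proof.
split=> [xy|<-]; last exact: vleUl.
by apply: le_anti; rewrite vleUx xy lexx vleUr.
Qed.

Lemma vjoin_idPl E (x y : E) : y <= x -> vjoin x y = x.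
Proof. by move=> yx; apply: le_anti; rewrite vleUx yx lexx vleUl. Qed.

Lemma ge0_vpos E (x : E) : 0 <= x -> vpos x = x.
Proof. exact: vjoin_idPl. Qed.

Lemma lattice_hom_mono E F (T : E -> F) :
  lattice_hom T -> {homo T : x y / x <= y}.
Proof. by case=> TU _ x y /vjoin_idPr xy; apply/vjoin_idPr; rewrite -TU xy. Qed.

Lemma lattice_hom_positive E F (T : {linear E -> F}) :
  lattice_hom T -> positive_op T.
Proof. by move=> hT x /(lattice_hom_mono hT); rewrite linear0. Qed.

(** The relation [x <= y] is the equation [vjoin x y = y], which an injective homomorphism
    reflects. *)
Lemma lattice_hom_inj_le E F (T : E -> F) :
  lattice_hom T -> injective T -> {mono T : x y / x <= y}.
Proof.
move=> hT injT x y; apply/idP/idP; last exact: lattice_hom_mono.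
by case: hT => TU _ /vjoin_idPr; rewrite -TU => /injT /vjoin_idPr.
Qed.

Lemma lattice_hom_vpos E F (T : {linear E -> F}) x :
  lattice_hom T -> T (vpos x) = vpos (T x).
Proof. by case=> TU _; rewrite /vpos TU linear0. Qed.

Lemma lattice_hom_vabs E F (T : {linear E -> F}) x :
  lattice_hom T -> T (vabs x) = vabs (T x).
Proof. by case=> TU _; rewrite /vabs TU linearN. Qed.

Lemma lattice_hom_comp E F (H : vectLatticeType R) (S : F -> H) (T : E -> F) :
  lattice_hom S -> lattice_hom T -> lattice_hom (S \o T).
Proof. by move=> [SU SI] [TU TI]; split=> x y /=; rewrite ?TU ?TI ?SU ?SI. Qed.

Lemma positive_op_le E F (T : {linear E -> F}) :
  positive_op T -> {homo T : x y / x <= y}.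
Proof. by move=> T0 x y xy; rewrite -vl_subr_ge0 -linearB T0 ?vl_subr_ge0. Qed.

Lemma vabs_leP E (x y : E) : (vabs x <= y) = (x <= y) && (- x <= y).
Proof. exact: vleUx. Qed.

Lemma positive_op_vabs_le E F (T : {linear E -> F}) x y :
  positive_op T -> vabs x <= y -> vabs (T x) <= T y.
Proof.
move=> /positive_op_le T0; rewrite !vabs_leP => /andP[xy Nxy].
by rewrite -linearN !T0.
Qed.

Lemma decreases_to0_ge0 E d (D : preorderType d) (v : D -> E) b :
  decreases_to0 v -> 0 <= v b.
Proof. by move=> [_ [lb _]]; apply: lb; exists b. Qed.

Lemma decreases_to0_order_cvg E d (D : preorderType d) (v : D -> E) :
  directed D -> decreases_to0 v -> order_cvg v 0.
Proof.
move=> dD dv; exists _, D, v; split=> // b; exists b => a ba.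
by rewrite subr0 ge0_vabs ?(decreases_to0_ge0 a dv) ?dv.1.
Qed.

(** Along a tail, [y - x <= v a - x <= vabs (v a - x)], so [y - x] is a lower bound of the
    dominating net and lies below its infimum 0. *)
Lemma lbound_order_cvg E d (D : preorderType d) (v : D -> E) x y :
  directed D -> order_cvg v x -> (forall b, y <= v b) -> y <= x.
Proof.
move=> [_ dD] [d' [D' [w [_ [_ [_ winf]] vw]]]] yv.
rewrite -vl_subr_ge0 -vl_oppr_le0 opprB; apply: winf => _ [b _ <-].
have [a0 /(_ a0 (lexx _))] := vw b; rewrite vabs_leP => /andP[h _].
by apply: le_trans h; rewrite vl_lerD2r.
Qed.

(* For positive operators, order continuity needs testing only on nets
   decreasing to 0. *)
Lemma positive_order_continuousP E F (T : {linear E -> F}) : positive_op T ->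
  order_continuous T <->
  forall d (D : preorderType d) (v : D -> E), directed D ->
    decreases_to0 v -> decreases_to0 (T \o v).
Proof.
move=> T0; split=> [oc d D v dD dv|h d D u x dD [d' [D' [v [dD' dv uv]]]]].
  split=> [a b ab|]; first by rewrite /= positive_op_le ?dv.1.
  split=> [_ [b _ <-]|z zlb]; first by rewrite /= T0 // (decreases_to0_ge0 b dv).
  have := oc _ _ _ _ dD (decreases_to0_order_cvg dD dv).
  by rewrite linear0 => /lbound_order_cvg; apply=> // b; apply: zlb; exists b.
exists _, D', (T \o v); split=> // [|b]; first exact: h.
have [a0 ua0] := uv b; exists a0 => a /ua0 uvb.
by rewrite /= -linearB positive_op_vabs_le.
Qed.

(** The image of a net decreasing to 0 is automatically decreasing and positive; what remains to be
    tested is that its lower bounds are at most 0. *)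
Lemma lattice_hom_order_continuousP E F (T : {linear E -> F}) :
  lattice_hom T ->
  (forall d (D : preorderType d) (v : D -> E), directed D ->
    decreases_to0 v -> forall z, (forall b, z <= T (v b)) -> z <= 0) ->
  order_continuous T.
Proof.
move=> /lattice_hom_positive T0 h; apply/(positive_order_continuousP T0).
move=> d D v dD dv; split=> [a b ab|]; first by rewrite /= positive_op_le ?dv.1.
split=> [_ [b _ <-]|z zlb]; first by rewrite /= T0 // (decreases_to0_ge0 b dv).
by apply: (h _ _ _ dD dv) => b; apply: zlb; exists b.
Qed.

Lemma NVL_id E : NVL (idfun : {linear E -> E}).
Proof. by split=> // d D u x. Qed.

Lemma NVL_comp E F (H : vectLatticeType R) (S : {linear F -> H})
    (T : {linear E -> F}) : NVL S -> NVL T -> NVL (S \o T : {linear E -> H}).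
Proof.
move=> [hS oS] [hT oT]; split=> [|d D u x dD ux]; first exact: lattice_hom_comp.
by apply: (oS _ _ (T \o u)) => //; apply: oT.
Qed.

Lemma IVL_id E : IVL (idfun : {linear E -> E}).
Proof. by split; [split | split=> // u _; rewrite image_id]. Qed.

Lemma IVL_comp E F (H : vectLatticeType R) (S : {linear F -> H})
    (T : {linear E -> F}) : IVL S -> IVL T -> IVL (S \o T : {linear E -> H}).
Proof.
move=> [hS [S0 iS]] [hT [T0 iT]]; split; first exact: lattice_hom_comp.
split=> [x x0|u u0]; first by rewrite /= S0 ?T0.
by rewrite -[LHS]/((S \o T) @` _)%classic -image_comp iT // iS ?T0.
Qed.

(** A preimage [x] anywhere in [E] suffices: its truncation [vmeet (vpos x) u] lies between 0 and
    [u], and a lattice homomorphism still sends it to [y]. *)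
Lemma interval_preservingP E F (T : {linear E -> F}) : lattice_hom T ->
  interval_preserving T <->
  forall u y, 0 <= u -> 0 <= y <= T u -> exists x, y = T x.
Proof.
move=> hT; have T0 := lattice_hom_positive hT.
split=> [[_ iT] u y u0 yu|h].
  have : (`[0, T u]%classic) y by rewrite /= in_itv.
  by rewrite -(iT u u0) => -[x _ <-]; exists x.
split=> // u u0; rewrite predeqE => y; split=> [[x]|] /=; rewrite !in_itv /=.
  move=> /andP[x0 xu] <-.
  by rewrite T0 // positive_op_le.
move=> yu; have [x yx] := h u y u0 yu.
have [y0 _] := andP yu.
exists (vmeet (vpos x) u); last first.
  rewrite hT.2 lattice_hom_vpos // -yx ge0_vpos //.
  by apply: le_anti; rewrite vleIl vlexI lexx; case/andP: yu.
by rewrite /= in_itv /= vlexI vpos_ge0 u0 vleIr.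
Qed.

Lemma interval_preserving_lift E F (T : {linear E -> F}) : lattice_hom T ->
  interval_preserving T -> forall u y, 0 <= u -> 0 <= y <= T u ->
  exists2 x, 0 <= x <= u & T x = y.
Proof.
move=> hT [_ iT] u y u0 yu.
have : (`[0, T u]%classic) y by rewrite /= in_itv.
by rewrite -(iT u u0) => -[x]; rewrite /= in_itv /= => xu <-; exists x.
Qed.

End VectorLattices.

(** * Convergence of monotone nets and of real nets *)

Section RegularOrderConvergence.
Context {R : realType} d (D : preorderType d).
Hypothesis dD : directed D.
Implicit Types u v : D -> R^o.

(** For [a] above [b] and far enough in the net, [x - v b <= x - v a <= vabs (v a - x)], so
    [x - v b] is a lower bound of the dominating net. *)
Lemma nonincreasing_order_cvg_le (E : vectLatticeType R) (v : D -> E) x b :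
  {homo v : a b / (a <= b)%O >-> b <= a} -> order_cvg v x -> x <= v b.
Proof.
move=> dec [d' [D' [w [_ [_ [_ winf]] vw]]]].
rewrite -vl_subr_ge0 -vl_oppr_le0 opprB; apply: winf => _ [c _ <-].
have [a0 va0] := vw c; have [a /andP[a0a ba]] := dD.2 a0 b.
have := va0 a a0a; rewrite vabs_leP opprB => /andP[_]; apply: le_trans.
by rewrite vl_lerD2l -[- v b <= _](vl_lerD2r (v b + v a)) addKr addrC addrK dec.
Qed.

Lemma regular_order_cvg_unique u x y : order_cvg u x -> order_cvg u y -> x = y.
Proof.
move=> /regular_order_cvgP ux /regular_order_cvgP uy.
apply/eqP; rewrite -subr_eq0 -normr_le0; apply/ler_addgt0Pl => e e0; rewrite addr0.
have [a xa] := ux _ (divr_gt0 e0 (ltr0n _ 2)).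
have [b yb] := uy _ (divr_gt0 e0 (ltr0n _ 2)).
have [c /andP[ac bc]] := dD.2 a b.
rewrite (_ : x - y = (u c - y) - (u c - x)); last by rewrite opprB [RHS]addrC addrA subrK.
rewrite (le_trans (ler_normB _ _)) // [e]splitr.
by apply: lerD; [exact: yb | exact: xa].
Qed.

Lemma regular_order_cvg_linear (c : R) u v x y :
  order_cvg u x -> order_cvg v y ->
  order_cvg (fun a => c *: u a + v a) (c *: x + y).
Proof.
move=> /regular_order_cvgP ux /regular_order_cvgP vy.
apply/regular_order_cvgP => e e0.
(* Dividing by the absolute value of [c] plus 1 also covers [c = 0]. *)
have c0 : 0 < `|c| + 1 by rewrite ltr_wpDl.
have e2 : 0 < e / 2 by rewrite divr_gt0.
have [a xa] := ux _ (divr_gt0 e2 c0).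
have [b yb] := vy _ e2.
have [m /andP[am bm]] := dD.2 a b; exists m => k mk.
rewrite opprD addrACA -scalerBr.
rewrite (le_trans (ler_normD _ _)) // [e in leRHS]splitr.
apply: lerD; last by apply: yb; apply: le_trans mk.
rewrite normrM (le_trans (ler_wpM2l _ (xa k (le_trans am mk)))) //.
rewrite mulrCA ler_piMr ?(ltW e2) //.
by rewrite ler_pdivrMr // mul1r lerDl ler01.
Qed.

Lemma nonincreasing_order_cvg_ex u :
  {homo u : a b / (a <= b)%O >-> b <= a} -> (forall a, 0 <= u a) ->
  exists l, order_cvg u l.
Proof.
move=> dec u0; have [[a0 _] _] := dD.
have uinf : has_inf (range (u : D -> R)).
  by split; [exists (u a0), a0 | exists 0 => _ [a _ <-]; apply: u0].
exists (inf (range (u : D -> R))); apply/regular_order_cvgP => e e0.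
have [_ [a _ <-] ua] := inf_adherent e0 uinf; exists a => b ab.
rewrite ger0_norm; last by rewrite subr_ge0; apply: (ge_inf uinf.2); exists b.
by rewrite lerBlDl (le_trans (dec _ _ ab)) // ltW.
Qed.

End RegularOrderConvergence.

(** * Pointwise limits of decreasing nets of order continuous functionals *)

Section OrderContinuousFunctionals.
Context {R : realType} {E : vectLatticeType R}.

Lemma odual_eq_ge0 (f g : odual E) : (forall x, 0 <= x -> f x = g x) -> f = g.
Proof.
by move=> fg; apply: le_anti; apply/andP; split; apply/odual_leP => x x0;
  rewrite fg.
Qed.

Lemma ncdual_leP (f g : ncdual E) :
  f <= g <-> forall x, 0 <= x -> f x <= g x.
Proof. by split=> [/odual_leP|fg] //; apply/odual_leP. Qed.

(** At a positive point the values form a decreasing real net bounded below, and a general point is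
    a difference of positive ones. The limit is order continuous because on the positive cone it is
    dominated by a single member [v b0] of the net. *)
Lemma ncdual_net_cvg d (D : preorderType d) (v : D -> ncdual E) :
  directed D -> {homo v : a b / (a <= b)%O >-> b <= a} ->
  (forall b, 0 <= v b) ->
  exists phi : ncdual E, forall x, order_cvg (fun b => v b x) (phi x).
Proof.
move=> dD dec v0.
have vge0 b x : 0 <= x -> 0 <= v b x by move: (v0 b) => /ncdual_leP; apply.
have lin (c : R) x y l m : order_cvg (fun b => v b x) l ->
    order_cvg (fun b => v b y) m ->
    order_cvg (fun b => v b (c *: x + y)) (c *: l + m).
  move=> xl ym; have := regular_order_cvg_linear dD c xl ym.
  by under eq_fun do rewrite -linearP.
have /choice [phi vphi] : forall x, exists l, order_cvg (fun b => v b x) l.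
  move=> x.
  have pos y : 0 <= y -> exists l, order_cvg (fun b => v b y) l.
    move=> y0; apply: (nonincreasing_order_cvg_ex dD) => [a b ab|a].
      by have /ncdual_leP := dec _ _ ab; apply.
    exact: vge0.
  have [l xl] := pos _ (vpos_ge0 x); have [m xm] := pos _ (vpos_ge0 (- x)).
  exists (- 1 *: m + l); rewrite [x]vpos_sub addrC -[- vpos (- x)]scaleN1r.
  exact: lin.
have philin : linear phi.
  move=> c x y; apply: (regular_order_cvg_unique dD (vphi _)).
  exact: lin.
pose T : {linear E -> R^o} := HB.pack phi (GRing.isLinear.Build R E R^o *:%R phi philin).
have T0 : positive_op T.
  move=> x x0; apply: (lbound_order_cvg dD (vphi x)) => b.
  exact: vge0.
have bT : order_bounded T.
  move=> x y; exists (T x), (T y) => z /andP[xz zy].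
  by rewrite !(positive_op_le T0).
have Tpred : phi \in @odual_pred R E by apply/odual_predP.
have [b0 _] := dD.1.
have Toc : Odual Tpred \in @ncdual_pred R E.
  apply/ncdual_predP; apply/(positive_order_continuousP T0) => d' D' w dD' dw.
  split=> [a b ab|]; first by rewrite /= (positive_op_le T0) ?dw.1.
  split=> [_ [b _ <-]|z zlb].
    by rewrite /= (T0 (w b)) // (decreases_to0_ge0 b dw).
  have /ncdual_predP oc := valP (v b0).
  have := oc _ _ _ _ dD' (decreases_to0_order_cvg dD' dw).
  rewrite linear0 => /lbound_order_cvg; apply=> // b.
  apply: (@le_trans _ _ (phi (w b))); first by apply: zlb; exists b.
  apply: (nonincreasing_order_cvg_le dD _ _ (vphi (w b))) => a a' aa'.
  have /ncdual_leP := dec _ _ aa'; apply; exact: (decreases_to0_ge0 b dw).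
by exists (NcDual Toc).
Qed.

(** The pointwise limit is itself an order continuous functional; it is positive and a lower bound
    of the net, hence equal to the infimum 0. *)
Lemma ncdual_decreases_to0 d (D : preorderType d) (v : D -> ncdual E) x :
  directed D -> decreases_to0 v -> order_cvg (fun b => v b x) 0.
Proof.
move=> dD dv; have v0 b := decreases_to0_ge0 b dv.
have [phi vphi] := ncdual_net_cvg dD dv.1 v0.
suff -> : 0 = phi x by [].
suff -> : phi = 0 by [].
apply: le_anti; apply/andP; split.
  apply: dv.2.2 => _ [b _ <-]; apply/ncdual_leP => y y0.
  apply: (nonincreasing_order_cvg_le dD _ _ (vphi y)) => a a' aa'.
  by have /ncdual_leP := dv.1 _ _ aa'; apply.
apply/ncdual_leP => y y0; apply: (lbound_order_cvg dD (vphi y)) => b.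
by have /ncdual_leP := v0 b; apply.
Qed.

End OrderContinuousFunctionals.

(** * Adjoints of interval preserving lattice homomorphisms *)

Section AdjointMorphisms.
Context {R : realType} {E F : vectLatticeType R} (T : {linear E -> F}).
Hypothesis hT : lattice_hom T.
Hypothesis iT : interval_preserving T.
Variables (T0 : positive_op T) (Toc : order_continuous T).

(** Since [T] maps the interval from 0 to [x] onto the one from 0 to [T x], both Riesz-Kantorovich
    formulas take the supremum of the same set. *)
Lemma odual_pos_map (f : odual F) :
  odual_pos (odual_map T0 f) = odual_map T0 (odual_pos f).
Proof.
apply: odual_eq_ge0 => x x0; rewrite [RHS](@odual_posE _ F f (T x)) ?T0 //.
rewrite odual_posE // /rk; congr (sup _); rewrite predeqE => r; split=> -[y /=].
  move=> /andP[y0 yx] <-; exists (T y) => //.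
  by rewrite /= T0 // (positive_op_le T0).
by move=> yTx <-; have [z zx <-] := interval_preserving_lift hT iT x0 yTx; exists z.
Qed.

(** Joins and meets in the dual are built linearly from the positive part of a difference, with
    which the adjoint commutes. *)
Lemma ncdual_map_lattice_hom : lattice_hom (ncdual_map T0 Toc).
Proof.
have posB (f g : ncdual F) :
    odual_pos (val (ncdual_map T0 Toc f) - val (ncdual_map T0 Toc g)) =
    odual_map T0 (odual_pos (val f - val g)).
  by rewrite -odual_pos_map; congr odual_pos; apply: odualP.
split=> f g; apply: ncdualP => x.
  by rewrite -[RHS]/((odual_pos (_ - _) + _ : odual E) x) posB.
by rewrite -[RHS]/((_ - odual_pos (_ - _) : odual E) x) posB.
Qed.

(** Nets decreasing to 0 in the dual do so pointwise, in particular at the points [T x]. *)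
Lemma ncdual_map_NVL : NVL (ncdual_map T0 Toc).
Proof.
split; first exact: ncdual_map_lattice_hom.
apply: (lattice_hom_order_continuousP ncdual_map_lattice_hom) => d D v dD dv z zv.
apply/ncdual_leP => x x0.
apply: (lbound_order_cvg dD (ncdual_decreases_to0 (T x) dD dv)) => b.
by have /ncdual_leP := zv b; apply.
Qed.

End AdjointMorphisms.

(** * The vector lattice of threads of an inverse system *)

Section Threads.
Context {R : realType} {d : Order.disp_t} {I : preorderType d}.
Variable H : inverse_system R I.

Definition lattice_hom_system : Prop :=
  forall a b (ab : (a <= b)%O), lattice_hom (ivs_map H ab).

(* The parameter [hH] makes the vector lattice structure, which exists only
   when the connecting maps are lattice homomorphisms, inferable from the type. *)
Record thread (hH : lattice_hom_system) := Thread {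
  thread_fun :> forall a, H a;
  threadP : forall a b (ab : (a <= b)%O), ivs_map H ab (thread_fun b) = thread_fun a
}.

Variable hH : lattice_hom_system.
Local Notation threads := (thread hH).
Implicit Types f g h : threads.

Lemma thread_eq f g : (forall a, f a = g a) -> f = g.
Proof.
case: f g => [f fP] [g gP] /= fg.
have {}fg : f = g by apply: functional_extensionality_dep.
by case: _ / fg gP => gP; congr Thread; apply: Prop_irrelevance.
Qed.

Fact thread_zeroP a b (ab : (a <= b)%O) : ivs_map H ab 0 = 0.
Proof. exact: linear0. Qed.
Fact thread_oppP f a b (ab : (a <= b)%O) : ivs_map H ab (- f b) = - f a.
Proof. by rewrite linearN threadP. Qed.
Fact thread_addP f g a b (ab : (a <= b)%O) :
  ivs_map H ab (f b + g b) = f a + g a.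
Proof. by rewrite linearD !threadP. Qed.
Fact thread_scaleP (c : R) f a b (ab : (a <= b)%O) :
  ivs_map H ab (c *: f b) = c *: f a.
Proof. by rewrite linearZ /= threadP. Qed.
Fact thread_joinP f g a b (ab : (a <= b)%O) :
  ivs_map H ab (vjoin (f b) (g b)) = vjoin (f a) (g a).
Proof. by rewrite (hH ab).1 !threadP. Qed.
Fact thread_meetP f g a b (ab : (a <= b)%O) :
  ivs_map H ab (vmeet (f b) (g b)) = vmeet (f a) (g a).
Proof. by rewrite (hH ab).2 !threadP. Qed.

Definition thread_zero : threads := Thread _ thread_zeroP.
Definition thread_opp f : threads := Thread _ (thread_oppP f).
Definition thread_add f g : threads := Thread _ (thread_addP f g).
Definition thread_scale c f : threads := Thread _ (thread_scaleP c f).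
Definition thread_join f g : threads := Thread _ (thread_joinP f g).
Definition thread_meet f g : threads := Thread _ (thread_meetP f g).
Definition thread_le f g : bool := `[< forall a, f a <= g a >].

HB.instance Definition _ := gen_eqMixin threads.
HB.instance Definition _ := gen_choiceMixin threads.

Fact thread_addA : associative thread_add.
Proof. by move=> f g h; apply: thread_eq => a /=; rewrite addrA. Qed.
Fact thread_addC : commutative thread_add.
Proof. by move=> f g; apply: thread_eq => a /=; rewrite addrC. Qed.
Fact thread_add0 : left_id thread_zero thread_add.
Proof. by move=> f; apply: thread_eq => a /=; rewrite add0r. Qed.
Fact thread_addN : left_inverse thread_zero thread_opp thread_add.
Proof. by move=> f; apply: thread_eq => a /=; rewrite addNr. Qed.

HB.instance Definition _ := GRing.isZmodule.Build threads
  thread_addA thread_addC thread_add0 thread_addN.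

Fact thread_scaleA b c f :
  thread_scale b (thread_scale c f) = thread_scale (b * c) f.
Proof. by apply: thread_eq => a /=; rewrite scalerA. Qed.
Fact thread_scale1 : left_id 1 thread_scale.
Proof. by move=> f; apply: thread_eq => a /=; rewrite scale1r. Qed.
Fact thread_scaleDr : right_distributive thread_scale +%R.
Proof. by move=> c f g; apply: thread_eq => a /=; rewrite scalerDr. Qed.
Fact thread_scaleDl f : {morph thread_scale^~ f : b c / b + c}.
Proof. by move=> b c; apply: thread_eq => a /=; rewrite scalerDl. Qed.

HB.instance Definition _ := GRing.Zmodule_isLmodule.Build R threads
  thread_scaleA thread_scale1 thread_scaleDr thread_scaleDl.

Fact thread_le_refl : reflexive thread_le.
Proof. by move=> f; apply/asboolP. Qed.
Fact thread_le_anti : antisymmetric thread_le.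
Proof.
move=> f g /andP[/asboolP fg /asboolP gf]; apply: thread_eq => a.
by apply: le_anti; rewrite fg gf.
Qed.
Fact thread_le_trans : transitive thread_le.
Proof.
move=> g f h /asboolP fg /asboolP gh; apply/asboolP => a.
exact: le_trans (fg a) (gh a).
Qed.

HB.instance Definition _ := Order.Le_isPOrder.Build ring_display threads
  thread_le_refl thread_le_anti thread_le_trans.

Lemma thread_leP f g : reflect (forall a, f a <= g a) (f <= g).
Proof. exact: asboolP. Qed.

Fact thread_lerD2r h f g : f <= g -> f + h <= g + h.
Proof. by move=> /thread_leP fg; apply/thread_leP => a; rewrite vl_lerD2r. Qed.
Fact thread_scaler_ge0 (c : R) f : 0 <= c -> 0 <= f -> 0 <= c *: f.
Proof.
by move=> c0 /thread_leP f0; apply/thread_leP => a; apply: vl_scaler_ge0 (f0 a).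
Qed.
Fact thread_lexI f g h : (f <= thread_meet g h) = (f <= g) && (f <= h).
Proof.
apply/thread_leP/andP => [fgh|[/thread_leP fg /thread_leP fh] a]; last first.
  by rewrite vlexI fg fh.
by split; apply/thread_leP => a; have := fgh a; rewrite vlexI => /andP[].
Qed.
Fact thread_leUx f g h : (thread_join f g <= h) = (f <= h) && (g <= h).
Proof.
apply/thread_leP/andP => [fgh|[/thread_leP fh /thread_leP gh] a]; last first.
  by rewrite vleUx fh gh.
by split; apply/thread_leP => a; have := fgh a; rewrite vleUx => /andP[].
Qed.

HB.instance Definition _ := Lmodule_POrder_isVectorLattice.Build R threads
  thread_lerD2r thread_scaler_ge0 thread_lexI thread_leUx.

Definition thread_proj a f : H a := f a.

Fact thread_proj_linear a : linear (thread_proj a).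
Proof. by []. Qed.

HB.instance Definition _ a :=
  GRing.isLinear.Build R threads (H a) *:%R (thread_proj a) (thread_proj_linear a).

Section Universal.
Variables (G : vectLatticeType R) (q : forall a, {linear G -> H a}).
Hypothesis qP : forall a b (ab : (a <= b)%O) x, ivs_map H ab (q b x) = q a x.

Definition to_thread (x : G) : threads := Thread _ (fun a b ab => qP ab x).

Fact to_thread_linear : linear to_thread.
Proof. by move=> c x y; apply: thread_eq => a /=; rewrite linearP. Qed.

HB.instance Definition _ :=
  GRing.isLinear.Build R G threads *:%R to_thread to_thread_linear.

Lemma to_thread_lattice_hom : (forall a, lattice_hom (q a)) ->
  lattice_hom to_thread.
Proof.
by move=> hq; split=> x y; apply: thread_eq => a /=;
  [rewrite (hq a).1 | rewrite (hq a).2].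
Qed.

(** Each coordinate of a lower bound of the image net is a lower bound of a net [q a \o v], which
    decreases to 0 by order continuity of [q a]. *)
Lemma to_thread_NVL : (forall a, NVL (q a)) -> NVL to_thread.
Proof.
move=> Nq; have hq a := (Nq a).1; have hs := to_thread_lattice_hom hq.
split=> //; apply: (lattice_hom_order_continuousP hs) => d' D v dD dv z zv.
apply/thread_leP => a.
have := (positive_order_continuousP (lattice_hom_positive (hq a))).1 (Nq a).2.
move=> /(_ _ _ _ dD dv)[_ [_]]; apply=> _ [b _ <-].
by have /thread_leP/(_ a) := zv b.
Qed.

End Universal.

(** The projections respect the lattice operations by construction, while their order continuity
    depends on the system. The mediating map is unique because its coordinates are prescribed. *)
Lemma thread_is_inverse_limit : (forall a, order_continuous (thread_proj a)) ->
  is_inverse_limit NVL (fun a => thread_proj a : {linear threads -> H a}).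
Proof.
move=> oc; split; first by split=> [a|a b ab f]; [split=> //; exact: oc | exact: threadP].
move=> G q [Nq qP]; exists (to_thread qP : {linear G -> threads}); split=> //.
  exact: to_thread_NVL.
by move=> s _ sq x; apply: thread_eq => a; rewrite /= -sq.
Qed.

End Threads.

(** * The inverse limit of the order continuous dual system *)

Section DualThreads.
Context {R : realType} {d : Order.disp_t} {I : preorderType d}.
Variables (D : direct_system R I) (DN : direct_system_in NIVL D).

Lemma ncdual_system_lattice_hom : lattice_hom_system (ncdual_system DN).
Proof. by move=> a b ab; have [? _ ?] := DN ab; apply: ncdual_map_lattice_hom. Qed.

Local Notation dual_thread := (thread ncdual_system_lattice_hom).

(* The pointwise limit of a decreasing net of threads is again a thread. *)
Lemma dual_thread_proj_order_continuous a :
  order_continuous (@thread_proj _ _ _ _ ncdual_system_lattice_hom a).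
Proof.
apply: lattice_hom_order_continuousP => // d' D' v dD' dv z zv.
have va_dec b : {homo (fun k => (v k b : ncdual (D b))) : i j / (i <= j)%O >-> j <= i}.
  by move=> i j ij; have /thread_leP/(_ b) := dv.1 i j ij.
have va0 b k : 0 <= (v k b : ncdual (D b)).
  by have /thread_leP/(_ b) := decreases_to0_ge0 k dv.
pose phi b := projT1 (cid (ncdual_net_cvg dD' (va_dec b) (va0 b))).
have vphi b x : order_cvg (fun k => (v k b : ncdual (D b)) x) (phi b x).
  exact: (projT2 (cid (ncdual_net_cvg dD' (va_dec b) (va0 b))) x).
have phiP b c (bc : (b <= c)%O) :
    ivs_map (ncdual_system DN) bc (phi c) = phi b.
  apply: ncdualP => x; apply: (regular_order_cvg_unique dD' _ (vphi b x)).
  suff -> : (fun k => (v k b : ncdual (D b)) x) =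
      (fun k => (v k c : ncdual (D c)) (ds_map D bc x)) by exact: vphi.
  by apply: funext => k; rewrite -(threadP (v k) bc).
pose f : dual_thread := Thread _ phiP.
(* The bound [z] lives in the single coordinate [a], whereas [f] is a thread and can be compared
   with the infimum of [v]; then [z <= phi a <= 0]. *)
have f_le0 : f <= 0.
  apply: dv.2.2 => _ [k _ <-]; apply/thread_leP => b; apply/ncdual_leP => x x0.
  apply: (nonincreasing_order_cvg_le dD' _ _ (vphi b x)) => i j ij.
  by have /ncdual_leP := va_dec b _ _ ij; apply.
have /thread_leP/(_ a) := f_le0; apply: le_trans.
apply/ncdual_leP => x x0; apply: (lbound_order_cvg dD' (vphi a x)) => k.
by have /ncdual_leP := zv k; apply.
Qed.

Lemma dual_thread_is_inverse_limit :
  is_inverse_limit NVL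
    (fun a => @thread_proj _ _ _ _ ncdual_system_lattice_hom a :
                {linear dual_thread -> ncdual_system DN a}).
Proof. exact: thread_is_inverse_limit dual_thread_proj_order_continuous. Qed.

End DualThreads.

(** * Vector sublattices as vector lattices *)

Section Sublattices.
Context {R : realType} {V : vectLatticeType R}.

(** Bundling the closure proofs with the predicate makes the structure on [subvl P] inferable from
    [P]. *)
Record sublattice := Sublattice {
  sublattice_pred : {pred V};
  sublattice_submod : submod_closed sublattice_pred;
  sublattice_join : forall x y, x \in sublattice_pred -> y \in sublattice_pred ->
    vjoin x y \in sublattice_pred;
  sublattice_meet : forall x y, x \in sublattice_pred -> y \in sublattice_pred ->
    vmeet x y \in sublattice_pred
}.

HB.instance Definition _ (P : sublattice) :=
  GRing.isSubmodClosed.Build R V (sublattice_pred P) (sublattice_submod P).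

Variable P : sublattice.

Record subvl : Type :=
  SubVL { subvl_val : V; _ : subvl_val \in sublattice_pred P }.

HB.instance Definition _ := [isSub for subvl_val].
HB.instance Definition _ := [Choice of subvl by <:].
HB.instance Definition _ := [SubChoice_isSubLmodule of subvl by <:].
HB.instance Definition _ :=
  Order.SubChoice_isSubPOrder.Build ring_display V (sublattice_pred P)
    ring_display subvl.

Definition subvl_join (x y : subvl) : subvl :=
  SubVL (sublattice_join (valP x) (valP y)).
Definition subvl_meet (x y : subvl) : subvl :=
  SubVL (sublattice_meet (valP x) (valP y)).

Fact subvl_lerD2r (z x y : subvl) : x <= y -> x + z <= y + z.
Proof. by rewrite !leEsub /= vl_lerD2r. Qed.
Fact subvl_scaler_ge0 (c : R) (x : subvl) : 0 <= c -> 0 <= x -> 0 <= c *: x.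
Proof. by rewrite !leEsub /=; apply: vl_scaler_ge0. Qed.
Fact subvl_lexI (x y z : subvl) : (x <= subvl_meet y z) = (x <= y) && (x <= z).
Proof. by rewrite !leEsub /= vlexI. Qed.
Fact subvl_leUx (x y z : subvl) : (subvl_join x y <= z) = (x <= z) && (y <= z).
Proof. by rewrite !leEsub /= vleUx. Qed.

HB.instance Definition _ := Lmodule_POrder_isVectorLattice.Build R subvl
  subvl_lerD2r subvl_scaler_ge0 subvl_lexI subvl_leUx.

Fact subvl_val_linear : linear subvl_val.
Proof. by []. Qed.

HB.instance Definition _ :=
  GRing.isLinear.Build R subvl V *:%R subvl_val subvl_val_linear.

Lemma subvl_val_lattice_hom : lattice_hom subvl_val.
Proof. by []. Qed.

Lemma subvl_val_inj : injective subvl_val.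
Proof. exact: val_inj. Qed.

Section Corestriction.
Context {W : vectLatticeType R} (T : {linear W -> V}).
Hypothesis TP : forall x, T x \in sublattice_pred P.

Definition corestrict (x : W) : subvl := SubVL (TP x).

Fact corestrict_linear : linear corestrict.
Proof. by move=> c x y; apply: subvl_val_inj; rewrite /= linearP. Qed.

HB.instance Definition _ :=
  GRing.isLinear.Build R W subvl *:%R corestrict corestrict_linear.

Lemma corestrict_lattice_hom : lattice_hom T -> lattice_hom corestrict.
Proof. by move=> [TU TI]; split=> x y; apply: subvl_val_inj; rewrite /= ?TU ?TI. Qed.

End Corestriction.

End Sublattices.

(** * The directed union of the images of a compatible family *)

Section ImageUnion.
Context {R : realType} {d : Order.disp_t} {I : preorderType d}.
Variables (dirI : directed I) (D : direct_system R I) (F : vectLatticeType R).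
Variable f : forall a, {linear D a -> F}.
Hypothesis hf : forall a, lattice_hom (f a).
Hypothesis fP : forall a b (ab : (a <= b)%O) x, f b (ds_map D ab x) = f a x.

Definition image_union_pred : {pred F} := fun x => `[< exists a y, f a y = x >].

(** Moving two elements to a common index reduces closure of the union to closure of one image. *)
Lemma image_union_pair x y : x \in image_union_pred -> y \in image_union_pred ->
  exists a x' y', x = f a x' /\ y = f a y'.
Proof.
move=> /asboolP[a [x' <-]] /asboolP[b [y' <-]].
have [c /andP[ac bc]] := dirI.2 a b.
by exists c, (ds_map D ac x'), (ds_map D bc y'); rewrite !fP.
Qed.

Fact image_union_submod : submod_closed image_union_pred.
Proof.
split; first by have [a _] := dirI.1; apply/asboolP; exists a, 0; rewrite linear0.
move=> c x y xP yP; have [a [x' [y' [-> ->]]]] := image_union_pair xP yP.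
by apply/asboolP; exists a, (c *: x' + y'); rewrite linearP.
Qed.

Fact image_union_join x y : x \in image_union_pred -> y \in image_union_pred ->
  vjoin x y \in image_union_pred.
Proof.
move=> xP yP; have [a [x' [y' [-> ->]]]] := image_union_pair xP yP.
by apply/asboolP; exists a, (vjoin x' y'); rewrite (hf a).1.
Qed.

Fact image_union_meet x y : x \in image_union_pred -> y \in image_union_pred ->
  vmeet x y \in image_union_pred.
Proof.
move=> xP yP; have [a [x' [y' [-> ->]]]] := image_union_pair xP yP.
by apply/asboolP; exists a, (vmeet x' y'); rewrite (hf a).2.
Qed.

Definition image_union : sublattice :=
  Sublattice image_union_submod image_union_join image_union_meet.

Fact image_unionP a x : f a x \in sublattice_pred image_union.
Proof. by apply/asboolP; exists a, x. Qed.

Definition to_image_union a : {linear D a -> subvl image_union} :=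
  corestrict (@image_unionP a).

Lemma subvl_image_union (x : subvl image_union) :
  exists a y, to_image_union a y = x.
Proof.
have /asboolP[a [y yx]] := valP x; exists a, y.
exact: subvl_val_inj.
Qed.

(** The maps [f a] are not assumed interval preserving into [F]. The hypothesis only makes each
    image an ideal of the union, which is enough for the corestrictions. *)
Lemma to_image_union_compatible :
  (forall a b u y, 0 <= f b y <= f a u -> exists x, f b y = f a x) ->
  direct_compatible IVL to_image_union.
Proof.
move=> h; split=> [a|a b ab x]; last by apply: subvl_val_inj; exact: fP.
have ha : lattice_hom (to_image_union a) by exact/corestrict_lattice_hom.
split=> //; apply/(interval_preservingP ha) => u y u0.
have [b [z <-]] := subvl_image_union y.
rewrite !leEsub => /= zu; have [x zx] := h a b u z zu.
by exists x; apply: subvl_val_inj.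
Qed.

End ImageUnion.

(** * The reduced product of a family over a directed set *)

Section ReducedProduct.
Context {R : realType} {d : Order.disp_t} {I : preorderType d}.
Variables (dirI : directed I) (F : I -> vectLatticeType R).
Implicit Types f g h : forall c, F c.

Definition eventually (P : I -> Prop) := exists a, forall c, (a <= c)%O -> P c.

Lemma eventually2 (P Q S : I -> Prop) : (forall c, P c -> Q c -> S c) ->
  eventually P -> eventually Q -> eventually S.
Proof.
move=> PQS [a Pa] [b Qb]; have [c /andP[ac bc]] := dirI.2 a b; exists c => k ck.
by apply: PQS; [apply: Pa (le_trans ac ck) | apply: Qb (le_trans bc ck)].
Qed.

Lemma eventually1 (P S : I -> Prop) : (forall c, P c -> S c) ->
  eventually P -> eventually S.
Proof. by move=> PS Pe; apply: (eventually2 _ Pe Pe) => c _; apply: PS. Qed.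

Lemma eventually0 (P : I -> Prop) : (forall c, P c) -> eventually P.
Proof. by have [a _] := dirI.1; exists a. Qed.

Definition germ_rel f g : bool := `[< eventually (fun c => f c = g c) >].

Fact germ_rel_refl : reflexive germ_rel.
Proof. by move=> f; apply/asboolP/eventually0. Qed.
Fact germ_rel_sym : symmetric germ_rel.
Proof. by move=> f g; apply/asboolP/asboolP; apply: eventually1. Qed.
Fact germ_rel_trans : transitive germ_rel.
Proof.
move=> g f h /asboolP fg /asboolP gh; apply/asboolP.
by apply: eventually2 fg gh => c ->.
Qed.

Canonical germ_equiv :=
  EquivRel germ_rel germ_rel_refl germ_rel_sym germ_rel_trans.

Definition reduced_product := {eq_quot germ_equiv}%qT.

HB.instance Definition _ := Choice.on reduced_product.

Local Notation Q := reduced_product.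

Definition germ f : Q := (\pi_({eq_quot germ_equiv}) f)%qT.

Lemma germP f g : germ f = germ g <-> eventually (fun c => f c = g c).
Proof.
by split=> [/eqquotP/asboolP|fg]; last by apply/eqquotP/asboolP.
Qed.

Lemma germ_surj (q : Q) : exists f, q = germ f.
Proof. by exists (repr q); rewrite /germ reprK. Qed.

Lemma germ_repr f : eventually (fun c => repr (germ f) c = f c).
Proof. by apply/germP; rewrite /germ reprK. Qed.

(** Operations are computed on the representatives picked by [repr]; [germ_opE] shows that the
    choice does not matter. *)
Definition germ_op (op : forall c, F c -> F c -> F c) (p q : Q) : Q :=
  germ (fun c => op c (repr p c) (repr q c)).

Lemma germ_opE op f g :
  germ_op op (germ f) (germ g) = germ (fun c => op c (f c) (g c)).
Proof. by apply/germP; apply: eventually2 (germ_repr f) (germ_repr g) => c -> ->. Qed.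

Definition germ_add := germ_op (fun c => +%R).
Definition germ_zero : Q := germ (fun c => 0).
(** Scaling is written as a binary operation with a dummy second argument so that [germ_opE] applies
    to it as well. *)
Definition germ_scale (k : R) := germ_op (fun c x _ => k *: x) ^~ germ_zero.
Definition germ_opp := germ_scale (-1).
Definition germ_join := germ_op (fun c => vjoin).
Definition germ_meet := germ_op (fun c => vmeet).
Definition germ_le (p q : Q) : bool :=
  `[< eventually (fun c => repr p c <= repr q c) >].

Lemma germ_scaleE k f : germ_scale k (germ f) = germ (fun c => k *: f c).
Proof. exact: germ_opE. Qed.

Fact germ_le_germ f g : germ_le (germ f) (germ g) =
  `[< eventually (fun c => f c <= g c) >].
Proof.
have fgE := eventually2 (fun c => @conj _ _) (germ_repr f) (germ_repr g).
by apply/asboolP/asboolP => le_fg; apply: eventually2 fgE le_fg => c [-> ->].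
Qed.

Fact germ_addA : associative germ_add.
Proof.
move=> p q r; have [f ->] := germ_surj p; have [g ->] := germ_surj q.
have [h ->] := germ_surj r; rewrite /germ_add !germ_opE.
by apply/germP/eventually0 => c; rewrite addrA.
Qed.
Fact germ_addC : commutative germ_add.
Proof.
move=> p q; have [f ->] := germ_surj p; have [g ->] := germ_surj q.
by rewrite /germ_add !germ_opE; apply/germP/eventually0 => c; rewrite addrC.
Qed.
Fact germ_add0 : left_id germ_zero germ_add.
Proof.
move=> p; have [f ->] := germ_surj p; rewrite /germ_add !germ_opE.
by apply/germP/eventually0 => c; rewrite add0r.
Qed.
Fact germ_addN : left_inverse germ_zero germ_opp germ_add.
Proof.
move=> p; have [f ->] := germ_surj p.
rewrite /germ_opp germ_scaleE /germ_add germ_opE.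
by apply/germP/eventually0 => c /=; rewrite scaleN1r addNr.
Qed.

HB.instance Definition _ := GRing.isZmodule.Build Q
  germ_addA germ_addC germ_add0 germ_addN.

Lemma germD f g : germ f + germ g = germ (fun c => f c + g c).
Proof. exact: germ_opE. Qed.

Fact germ_scaleA j k q : germ_scale j (germ_scale k q) = germ_scale (j * k) q.
Proof.
have [f ->] := germ_surj q; rewrite !germ_scaleE.
by apply/germP/eventually0 => c; rewrite scalerA.
Qed.
Fact germ_scale1 : left_id 1 germ_scale.
Proof.
move=> q; have [f ->] := germ_surj q; rewrite !germ_scaleE.
by apply/germP/eventually0 => c; rewrite scale1r.
Qed.
Fact germ_scaleDr : right_distributive germ_scale +%R.
Proof.
move=> k p q; have [f ->] := germ_surj p; have [g ->] := germ_surj q.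
rewrite germD !germ_scaleE germD.
by apply/germP/eventually0 => c; rewrite scalerDr.
Qed.
Fact germ_scaleDl q : {morph germ_scale^~ q : j k / j + k}.
Proof.
move=> j k; have [f ->] := germ_surj q; rewrite !germ_scaleE germD.
by apply/germP/eventually0 => c; rewrite scalerDl.
Qed.

HB.instance Definition _ := GRing.Zmodule_isLmodule.Build R Q
  germ_scaleA germ_scale1 germ_scaleDr germ_scaleDl.

Lemma germZ (k : R) f : k *: germ f = germ (fun c => k *: f c).
Proof. exact: germ_scaleE. Qed.

Fact germ_le_refl : reflexive germ_le.
Proof. by move=> p; apply/asboolP/eventually0. Qed.
Fact germ_le_anti : antisymmetric germ_le.
Proof.
move=> p q /andP[]; have [f ->] := germ_surj p; have [g ->] := germ_surj q.
rewrite !germ_le_germ => /asboolP fg /asboolP gf; apply/germP.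
by apply: eventually2 fg gf => c fgc gfc; apply: le_anti; rewrite fgc.
Qed.
Fact germ_le_trans : transitive germ_le.
Proof.
move=> q p r; have [f ->] := germ_surj p; have [g ->] := germ_surj q.
have [h ->] := germ_surj r; rewrite !germ_le_germ => /asboolP fg /asboolP gh.
by apply/asboolP; apply: eventually2 fg gh => c; apply: le_trans.
Qed.

HB.instance Definition _ := Order.Le_isPOrder.Build ring_display Q
  germ_le_refl germ_le_anti germ_le_trans.

Lemma germ_leP f g : reflect (eventually (fun c => f c <= g c)) (germ f <= germ g).
Proof. by rewrite [_ <= _]germ_le_germ; apply: asboolP. Qed.

Fact germ_lerD2r (r p q : Q) : p <= q -> p + r <= q + r.
Proof.
have [f ->] := germ_surj p; have [g ->] := germ_surj q.
have [h ->] := germ_surj r; rewrite !germD => /germ_leP fg; apply/germ_leP.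
by apply: eventually1 fg => c; rewrite vl_lerD2r.
Qed.
Fact germ_scaler_ge0 (k : R) (q : Q) : 0 <= k -> 0 <= q -> 0 <= k *: q.
Proof.
move=> k0; have [f ->] := germ_surj q; rewrite germZ => /germ_leP f0.
by apply/germ_leP; apply: eventually1 f0 => c; apply: vl_scaler_ge0.
Qed.
Fact germ_lexI (p q r : Q) : (p <= germ_meet q r) = (p <= q) && (p <= r).
Proof.
have [f ->] := germ_surj p; have [g ->] := germ_surj q.
have [h ->] := germ_surj r; rewrite /germ_meet germ_opE.
apply/germ_leP/andP => [fgh|[/germ_leP fg /germ_leP fh]]; last first.
  by apply: eventually2 fg fh => c fg fh; rewrite vlexI fg.
by split; apply/germ_leP; apply: eventually1 fgh => c; rewrite vlexI => /andP[].
Qed.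
Fact germ_leUx (p q r : Q) : (germ_join p q <= r) = (p <= r) && (q <= r).
Proof.
have [f ->] := germ_surj p; have [g ->] := germ_surj q.
have [h ->] := germ_surj r; rewrite /germ_join germ_opE.
apply/germ_leP/andP => [fgh|[/germ_leP fg /germ_leP fh]]; last first.
  by apply: eventually2 fg fh => c fg fh; rewrite vleUx fg.
by split; apply/germ_leP; apply: eventually1 fgh => c; rewrite vleUx => /andP[].
Qed.

HB.instance Definition _ := Lmodule_POrder_isVectorLattice.Build R Q
  germ_lerD2r germ_scaler_ge0 germ_lexI germ_leUx.

Lemma germU f g : vjoin (germ f) (germ g) = germ (fun c => vjoin (f c) (g c)).
Proof. exact: germ_opE. Qed.
Lemma germI f g : vmeet (germ f) (germ g) = germ (fun c => vmeet (f c) (g c)).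
Proof. exact: germ_opE. Qed.

End ReducedProduct.

(** * Injectivity and joint surjectivity of the maps into a direct limit *)

Section DirectLimits.
Context {R : realType} {d : Order.disp_t} {I : preorderType d}.
Variables (dirI : directed I) (D : direct_system R I).

(* The value 0 off the tail [a <= c] is junk: only the germ matters. *)
Definition extend a (x : D a) c : D c :=
  if pselect (a <= c)%O is left ac then ds_map D ac x else 0.

Lemma extendE a x c (ac : (a <= c)%O) : extend x c = ds_map D ac x.
Proof.
by rewrite /extend; case: pselect => // ac'; rewrite (bool_irrelevance ac ac').
Qed.

Definition extend_germ a (x : D a) : reduced_product dirI D :=
  germ dirI (extend x).

Fact extend_germ_linear a : linear (@extend_germ a).
Proof.
move=> k x y; rewrite /extend_germ germZ germD; apply/germP; exists a => c ac.
by rewrite !(extendE _ ac) linearP.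
Qed.

HB.instance Definition _ a := GRing.isLinear.Build R (D a)
  (reduced_product dirI D) *:%R (@extend_germ a) (@extend_germ_linear a).

Hypothesis ID : direct_system_in IVL D.

Lemma extend_germ_lattice_hom a : lattice_hom (@extend_germ a).
Proof.
split=> x y; rewrite /extend_germ ?germU ?germI; apply/germP; exists a => c ac.
  by rewrite !(extendE _ ac) (ID ac).1.1.
by rewrite !(extendE _ ac) (ID ac).1.2.
Qed.

Lemma extend_germ_compatible a b (ab : (a <= b)%O) x :
  extend_germ (ds_map D ab x) = extend_germ x.
Proof.
apply/germP; exists b => c bc; rewrite (extendE _ bc) (extendE _ (le_trans ab bc)).
exact: ds_comp.
Qed.

(* A germ between 0 and [extend_germ u] is already so at some index [c] above
   both [a] and [b], where the connecting map is interval preserving. *)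
Lemma extend_germ_solid a b u y :
  0 <= extend_germ (y : D b) <= extend_germ (u : D a) ->
  exists x : D a, extend_germ y = extend_germ x.
Proof.
move=> /andP[/germ_leP y0 /germ_leP yu].
have [c0 yc] := eventually2 dirI (fun c => @conj _ _) y0 yu.
have [c1 /andP[ac1 bc1]] := dirI.2 a b.
have [c /andP[c0c c1c]] := dirI.2 c0 c1.
have ac := le_trans ac1 c1c; have bc := le_trans bc1 c1c.
have [] := yc c c0c; rewrite (extendE _ bc) (extendE _ ac) => yc0 ycu.
have [hac iac] := ID ac.
(* Only the germ of [u] is known to be positive, so [vpos u] serves as the bound to lift under. *)
have [|x _ xy] := interval_preserving_lift hac iac (vpos_ge0 u) (y := ds_map D bc y).
  by rewrite yc0 lattice_hom_vpos // (le_trans ycu) ?vpos_ge.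
by exists x; rewrite -(extend_germ_compatible bc) -xy extend_germ_compatible.
Qed.

(** Equal germs agree at some index above [a], where they are values of one injective connecting
    map. *)
Lemma extend_germ_inj : (forall a b (ab : (a <= b)%O), injective (ds_map D ab)) ->
  forall a, injective (@extend_germ a).
Proof.
move=> injD a x y /germP[b xy]; have [c /andP[ac bc]] := dirI.2 a b.
by have := xy c bc; rewrite !(extendE _ ac) => /injD.
Qed.

Variables (E : vectLatticeType R) (e : forall a : I, {linear D a -> E}).
Hypothesis hE : is_direct_limit IVL e.

(** The universal property factors the injective map [extend_germ] through [e a]. *)
Lemma direct_limit_inj : (forall a b (ab : (a <= b)%O), injective (ds_map D ab)) ->
  forall a, injective (e a).
Proof.
move=> injD a x y exy.
have [r [_ re _]] := hE.2 _ _ (to_image_union_compatible dirI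
  extend_germ_lattice_hom extend_germ_compatible extend_germ_solid).
apply: (extend_germ_inj injD).
have := congr1 r exy; rewrite !re => /(congr1 (@subvl_val _ _ _)).
exact.
Qed.

(* By uniqueness, the map of [E] into the union of the images followed by the
   inclusion is the identity. *)
Lemma direct_limit_surj x : exists a y, e a y = x.
Proof.
have [[Ie eP] univ] := hE; have he a := (Ie a).1.
have e_solid a b u y : 0 <= e b y <= e a u -> exists x, e b y = e a x.
  move=> /andP[y0 yu].
  have [|z _ <-] := interval_preserving_lift (he a) (Ie a).2 (vpos_ge0 u) (y := e b y).
    by rewrite y0 lattice_hom_vpos // (le_trans yu) ?vpos_ge.
  by exists z.
have [r [Ir re _]] := univ _ _ (to_image_union_compatible dirI he eP e_solid).
set U := image_union dirI he eP in r Ir re.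
(* Uniqueness only compares morphisms of [IVL], so the inclusion has to be one; it is, since an
   element of [E] between 0 and some [e a v] lies in the image of [e a]. *)
have Iiota : IVL (subvl_val (P:=U)).
  split=> //; apply/(interval_preservingP (subvl_val_lattice_hom U)) => u y u0 yu.
  have [a [v uE]] := subvl_image_union u; move: yu.
  rewrite -uE /= => yu; have /andP[y0 yv] := yu.
  have [|z _ zy] := interval_preserving_lift (he a) (Ie a).2 (vpos_ge0 v) (y := y).
    by rewrite y0 lattice_hom_vpos // (le_trans yv) ?vpos_ge.
  by exists (to_image_union dirI he eP a z).
have [s [_ _ s_uniq]] := univ E e hE.1.
have <- : subvl_val (r x) = x.
  rewrite -[RHS]/(idfun x) -[LHS]/((subvl_val (P:=U) \o r) x).
  rewrite (s_uniq (subvl_val (P:=U) \o r : {linear E -> E})) ?(s_uniq idfun) //.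
  - exact: IVL_id.
  - exact: IVL_comp.
  - by move=> a y; rewrite /= re.
have [a [y <-]] := subvl_image_union (r x).
by exists a, y.
Qed.

End DirectLimits.

(* The image of an injective interval preserving lattice homomorphism is an
   ideal isomorphic to the domain, and lower bounds of a net in the image may be
   replaced by their positive parts, which lie in that ideal. *)
Lemma IVL_inj_order_continuous (R : realType) (E F : vectLatticeType R)
    (T : {linear E -> F}) : IVL T -> injective T -> order_continuous T.
Proof.
move=> [hT iT] injT; apply: (lattice_hom_order_continuousP hT).
move=> d D v dD dv z zv; have [[b0 _] _] := dD.
have T0 b : 0 <= T (v b).
  exact: (lattice_hom_positive hT (decreases_to0_ge0 b dv)).
have [|y _ yz] := interval_preserving_lift hT iT (decreases_to0_ge0 b0 dv) (y := vpos z).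
  by rewrite vpos_ge0 vleUx zv T0.
apply: le_trans (vpos_ge z) _; rewrite -yz -(linear0 T).
rewrite (lattice_hom_inj_le hT injT); apply: dv.2.2 => _ [b _ <-].
by rewrite -(lattice_hom_inj_le hT injT) yz vleUx zv T0.
Qed.

(** * Order continuous functionals on a directed union of ideals *)

Section DualOfDirectLimit.
Context {R : realType} {d : Order.disp_t} {I : preorderType d}.
Variables (dirI : directed I) (D : direct_system R I).
Variables (DN : direct_system_in NIVL D).
Variables (E : vectLatticeType R) (e : forall a : I, {linear D a -> E}).
Hypothesis eI : forall a, IVL (e a).
Hypothesis eP : forall a b (ab : (a <= b)%O) x, e b (ds_map D ab x) = e a x.
Hypothesis e_inj : forall a, injective (e a).
Hypothesis e_surj : forall x, exists a y, e a y = x.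

Local Notation dual_thread := (thread (ncdual_system_lattice_hom DN)).

Let he a : lattice_hom (e a) := (eI a).1.
Let e_le a := lattice_hom_inj_le (he a) (@e_inj a).

(** The maps [e a] are given only as morphisms of [IVL]; their injectivity supplies the order
    continuity that the adjoint requires. *)
Definition leg_map a : {linear ncdual E -> ncdual_system DN a} :=
  ncdual_map (lattice_hom_positive (he a))
    (IVL_inj_order_continuous (eI a) (@e_inj a)).

Fact leg_map_compatible a b (ab : (a <= b)%O) phi :
  ivs_map (ncdual_system DN) ab (leg_map b phi) = leg_map a phi.
Proof. by apply: ncdualP => x; rewrite /= eP. Qed.

Definition dual_to_thread : {linear ncdual E -> dual_thread} :=
  to_thread (ncdual_system_lattice_hom DN) leg_map_compatible.

Lemma dual_to_threadE phi a x :
  (dual_to_thread phi a : ncdual (D a)) x = phi (e a x).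
Proof. by []. Qed.

Lemma dual_to_thread_NVL : NVL dual_to_thread.
Proof. by apply: to_thread_NVL => a; apply: ncdual_map_NVL (he a) (eI a).2 _ _. Qed.

Lemma dual_to_thread_inj : injective dual_to_thread.
Proof.
move=> phi psi phipsi; apply: ncdualP => x; have [a [y <-]] := e_surj x.
by rewrite -!dual_to_threadE phipsi.
Qed.

Section Gluing.
Variable g : dual_thread.
Local Notation g_ a := (g a : ncdual (D a)).

Lemma thread_mapE a b (ab : (a <= b)%O) x : g_ b (ds_map D ab x) = g_ a x.
Proof. by rewrite -(threadP g ab). Qed.

(** The value is read off a chosen preimage. Two preimages become equal at a common index [c]
    because [e c] is injective, so the thread takes the same value on both. *)
Lemma thread_glue : exists phi : E -> R^o, forall a x, phi (e a x) = g_ a x.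
Proof.
have /choice[phi phiP] x : exists r, exists a y, e a y = x /\ r = g_ a y.
  by have [a [y yx]] := e_surj x; exists (g_ a y), a, y.
exists phi => a x; have [b [y [ey ->]]] := phiP (e a x).
have [c /andP[ac bc]] := dirI.2 a b.
rewrite -(thread_mapE ac) -(thread_mapE bc); congr (g_ c _).
by apply: (@e_inj c); rewrite !eP.
Qed.

Lemma e_surj2 x y : exists a x' y', e a x' = x /\ e a y' = y.
Proof.
have [a [x' <-]] := e_surj x; have [b [y' <-]] := e_surj y.
have [c /andP[ac bc]] := dirI.2 a b.
by exists c, (ds_map D ac x'), (ds_map D bc y'); rewrite !eP.
Qed.

Variable phi : E -> R^o.
Hypothesis phiE : forall a x, phi (e a x) = g_ a x.

Lemma glue_linear : linear phi.
Proof.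
move=> c x y; have [a [x' [y' [<- <-]]]] := e_surj2 x y.
by rewrite -linearP !phiE linearP.
Qed.

Lemma glue_order_bounded : order_bounded phi.
Proof.
move=> x y; have [a [x' [y' [<- <-]]]] := e_surj2 x y.
have [c [c' gcc']] := odual_bounded (g_ a) x' y'.
exists c, c' => z /andP[xz zy]; have xy := le_trans xz zy.
(* Translation by [e a x'] gives an interval starting at 0, which lifts to [D a]; bounds of [g a]
   between [x'] and [y'] thus bound [phi]. *)
have [||t tx zE] := interval_preserving_lift (he a) (eI a).2
  (u := y' - x') (y := z - e a x').
- by rewrite vl_subr_ge0 -e_le.
- by rewrite vl_subr_ge0 xz linearB vl_lerD2r.
have -> : z = e a (t + x') by rewrite linearD zE subrK.
rewrite phiE gcc' // -{1}[x']add0r vl_lerD2r.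
by rewrite -[t + x' <= y'](vl_lerD2r (- x')) addrK.
Qed.

(* A net dominated by [w], decreasing to 0, eventually lies in the ideal generated
   by one value [w b0 = e a u]; there it is the image under [e a] of a net that
   order converges to 0 in [D a]. *)
Lemma glue_order_continuous : order_continuous phi.
Proof.
move=> d1 D1 u x dD1 [d2 [D2 [w [dD2 dw uw]]]].
have [[b0 _] _] := dD2; have w0 b := decreases_to0_ge0 b dw.
have [a [t tE]] := e_surj (w b0).
have t0 : 0 <= t by rewrite -e_le linear0 tE w0.
(* Truncating at [w b0 = e a t] brings every [w b] into the image of [e a]; the index set of [w]
   need not be cut down to a tail. *)
have /choice[v vE] b : exists y, e a y = vmeet (w b) (w b0).
  have [|y _ yE] := interval_preserving_lift (he a) (eI a).2 t0 (y := vmeet (w b) (w b0)).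
    by rewrite tE vleIr vlexI !w0.
  by exists y.
have dv : decreases_to0 v.
  split=> [i j ij|].
    by rewrite -e_le !vE vlexI vleIr (le_trans (vleIl _ _)) ?dw.1.
  split=> [_ [b _ <-]|z zv]; first by rewrite -e_le linear0 vE vlexI !w0.
  rewrite -e_le linear0; apply: dw.2.2 => _ [b _ <-].
  have : z <= v b by apply: zv; exists b.
  by rewrite -e_le vE vlexI => /andP[].
(* The positive and negative parts of [u i - x] are lifted separately. Where the bound fails, the
   value 0 is arbitrary; this does not affect convergence, since the bound holds on a tail. *)
have /choice[y yE] i : exists y, vabs (u i - x) <= w b0 -> e a y = u i - x.
  have [uxw|nuxw] := pselect (vabs (u i - x) <= w b0); last by exists 0.
  have liftP z : z <= vabs (u i - x) -> exists y, e a y = vpos z.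
    move=> zw.
    have [|s _ sE] := interval_preserving_lift (he a) (eI a).2 t0 (y := vpos z).
      by rewrite vpos_ge0 tE vleUx w0 (le_trans zw uxw).
    by exists s.
  have [s sE] := liftP _ (vabs_ge _); have [r rE] := liftP _ (vabs_geN _).
  by exists (s - r) => _; rewrite linearB sE rE -vpos_sub.
have [i0 ui0] := uw b0.
have y_cvg : order_cvg y 0.
  exists _, D2, v; split=> // b; have [i1 ui1] := uw b.
  have [i2 /andP[i02 i12]] := dD1.2 i0 i1; exists i2 => i i2i.
  have yEi := yE i (ui0 i (le_trans i02 i2i)).
  rewrite subr0 -e_le vE lattice_hom_vabs // yEi vlexI.
  by rewrite (ui1 i (le_trans i12 i2i)) (ui0 i (le_trans i02 i2i)).
have /ncdual_predP goc := valP (g_ a).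
have /regular_order_cvgP := goc _ _ _ _ dD1 y_cvg; rewrite linear0 => gy.
apply/regular_order_cvgP => eps eps0; have [i1 gy1] := gy eps eps0.
have [i2 /andP[i02 i12]] := dD1.2 i0 i1; exists i2 => i i2i.
have -> : (phi \o u) i - phi x = g_ a (y i) - 0.
  rewrite subr0 -phiE (yE _ (ui0 i (le_trans i02 i2i))).
  by rewrite -[- x]scaleN1r [u i + _]addrC glue_linear scaleN1r addrC.
exact: gy1 (le_trans i12 i2i).
Qed.

End Gluing.

Lemma dual_to_thread_surj (g : dual_thread) : exists phi, dual_to_thread phi = g.
Proof.
have [phi phiE] := thread_glue g.
have phi_od : phi \in @odual_pred R E.
  by apply/odual_predP; split; [apply: glue_linear phiE | apply: glue_order_bounded phiE].
have phi_nc : Odual phi_od \in @ncdual_pred R E.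
  by apply/ncdual_predP; apply: glue_order_continuous phiE.
by exists (NcDual phi_nc); apply: thread_eq => a; apply: ncdualP => x; apply: phiE.
Qed.

End DualOfDirectLimit.

(** * Uniqueness of inverse limits and the duality isomorphism *)

Lemma inverse_limit_iso (R : realType) (d : Order.disp_t) (I : preorderType d)
    (H : inverse_system R I) (G G' : vectLatticeType R)
    (p : forall a, {linear G -> H a}) (p' : forall a, {linear G' -> H a}) :
  is_inverse_limit NVL p -> is_inverse_limit NVL p' ->
  exists s : {linear G' -> G},
    [/\ NVL s, bijective s & forall a x, p a (s x) = p' a x].
Proof.
move=> [cp up] [cp' up'].
have [s [Ns sP _]] := up _ _ cp'; have [t [Nt tP _]] := up' _ _ cp.
have [r [_ _ r_uniq]] := up _ _ cp; have [r' [_ _ r'_uniq]] := up' _ _ cp'.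
exists s; split=> //; exists t => x.
  (* Both [t \o s] and the identity mediate from the limit [G'] to itself, so uniqueness identifies
     them. *)
  rewrite -[LHS]/((t \o s) x) -[RHS]/(idfun x).
  rewrite (r'_uniq (t \o s : {linear G' -> G'})) ?(r'_uniq idfun) //.
  - exact: NVL_id.
  - exact: NVL_comp.
  - by move=> a y; rewrite /= tP sP.
rewrite -[LHS]/((s \o t) x) -[RHS]/(idfun x).
rewrite (r_uniq (s \o t : {linear G -> G})) ?(r_uniq idfun) //.
- exact: NVL_id.
- exact: NVL_comp.
- by move=> a y; rewrite /= sP tP.
Qed.

Theorem theorem5p5 (R : realType) (d : Order.disp_t) (I : preorderType d)
    (dirI : directed I)
    (D : direct_system R I) (DN : direct_system_in NIVL D)
    (E : vectLatticeType R) (e : forall a : I, {linear D a -> E})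
    (hE : is_direct_limit IVL e) :
  (exists (G : vectLatticeType R)
          (p : forall a : I, {linear G -> ncdual_system DN a}),
      is_inverse_limit NVL p) /\
  ((forall (a b : I) (ab : (a <= b)%O), injective (ds_map D ab)) ->
   forall (G : vectLatticeType R)
          (p : forall a : I, {linear G -> ncdual_system DN a}),
     is_inverse_limit NVL p ->
     exists S : {linear ncdual E -> G},
       [/\ lattice_hom S, bijective S &
           forall (a : I) (phi : ncdual E) (x : D a),
             (p a (S phi) : ncdual (D a)) x = phi (e a x)]).
Proof.
have limT := dual_thread_is_inverse_limit DN.
split; first by eexists; eexists; exact: limT.
move=> injD G p limG.
have ID : direct_system_in IVL D by move=> a b ab; have [] := DN a b ab.
have [[eI eP] _] := hE.
have e_inj := direct_limit_inj dirI ID hE injD.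
have e_surj := direct_limit_surj dirI hE.
pose S0 := dual_to_thread DN eI eP e_inj.
have S0_bij : bijective S0.
  have /choice[T TK] := dual_to_thread_surj dirI eI eP e_inj e_surj (DN := DN).
  exists T => [phi|]; last exact: TK.
  exact: (dual_to_thread_inj e_surj (TK _)).
(* The given limit [G] is arbitrary, so the isomorphism onto the threads is transported to it. *)
have [s [Ns s_bij sP]] := inverse_limit_iso limG limT.
exists (s \o S0 : {linear ncdual E -> G}); split.
- exact: lattice_hom_comp Ns.1 (dual_to_thread_NVL DN eI eP e_inj).1.
- exact: bij_comp.
- by move=> a phi x; rewrite /= sP.
Qed.
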